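(* For any state $\rho_{ABC}$ on finite-dimensional systems $A,B,C$, $$\Delta(\rho)\ge I(A:C|B)_\rho.$$
   Context: $I(A:C|B)_\rho=S(AB)+S(BC)-S(B)-S(ABC)$ is the quantum conditional mutual information, with $S$ the von Neumann entropy of the respective reduced states. A quantum Markov state on a tripartite system $XYZ$ is a state $\mu_{XYZ}$ for which there exist an orthogonal direct sum decomposition $\mathcal H_Y=\bigoplus_j b_j^L\otimes b_j^R$, a probability distribution $(p_j)$ and states $\mu^{(j)}_{Xb_j^L}$, $\mu^{(j)}_{b_j^RZ}$ with $\mu_{XYZ}=\bigoplus_j p_j\,\mu^{(j)}_{Xb_j^L}\otimes\mu^{(j)}_{b_j^RZ}$. $\Delta(\rho)=\inf D(\rho\|\mu)$, the infimum over all finite-dimensional systems $\widehat A\supseteq A$, $\widehat B\supseteq B$, $\widehat C\supseteq C$ (isometric embeddings, with $\rho$ regarded as a state on $\widehat A\widehat B\widehat C$) and all quantum Markov states $\mu$ on $\widehat A\widehat B\widehat C$, where $D(\rho\|\mu)=\operatorname{tr}\rho(\log\rho-\log\mu)$ is the quantum relative entropy. *)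

(* Defs.v *)
From HB Require Import structures.
From mathcomp Require Import all_boot all_order all_algebra.
From mathcomp Require Import classical_sets reals ereal exp.
From mathcomp.real_closed Require Import complex mxtens.
From mathcomp Require Import sesquilinear spectral.

Set Implicit Arguments.
Unset Strict Implicit.
Unset Printing Implicit Defensive.

Import Order.TTheory GRing.Theory Num.Theory.
Local Open Scope ring_scope.

Section Quantum.
Variable R : realType.
Local Notation C := (R[i]).

Definition adj {m n} (A : 'M[C]_(m, n)) : 'M[C]_(n, m) := map_mx Num.conj (trmx A).

Definition psdmx {n} (A : 'M[C]_n) : Prop :=
  adj A = A /\ forall v : 'rV[C]_n, 0 <= (v *m A *m adj v) 0 0.
Definition is_state {n} (A : 'M[C]_n) : Prop := psdmx A /\ \tr A = 1.

Definition isometry {n m} (V : 'M[C]_(n, m)) : Prop := adj V *m V = 1%:M.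

(* functional calculus via the spectral decomposition A = P^-1 diag(d) P
   (only meaningful for normal, here Hermitian, A) *)
Definition mxlog {n} (A : 'M[C]_n) : 'M[C]_n :=
  invmx (spectralmx A) *m
  diag_mx (map_mx (fun z : C => (ln (complex.Re z))%:C%C) (spectral_diag A)) *m
  spectralmx A.

Definition vN_entropy {n} (A : 'M[C]_n) : R := - complex.Re (\tr (A *m mxlog A)).

Definition ptrace_r {m n} (A : 'M[C]_(m * n)) : 'M[C]_m :=
  \matrix_(i, j) \sum_(k < n) A (mxtens_index (i, k)) (mxtens_index (j, k)).
Definition ptrace_l {m n} (A : 'M[C]_(m * n)) : 'M[C]_n :=
  \matrix_(i, j) \sum_(k < m) A (mxtens_index (k, i)) (mxtens_index (k, j)).

Definition mxassoc {a b c} (M : 'M[C]_(a * b * c)) : 'M[C]_(a * (b * c)) :=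
  \matrix_(u, v)
    let: (x, yz) := mxtens_unindex u in let: (y, z) := mxtens_unindex yz in
    let: (x', yz') := mxtens_unindex v in let: (y', z') := mxtens_unindex yz' in
    M (mxtens_index (mxtens_index (x, y), z))
      (mxtens_index (mxtens_index (x', y'), z')).

Definition red_AB {a b c} (rho : 'M[C]_(a * b * c)) : 'M[C]_(a * b) := ptrace_r rho.
Definition red_BC {a b c} (rho : 'M[C]_(a * b * c)) : 'M[C]_(b * c) :=
  ptrace_l (mxassoc rho).
Definition red_B {a b c} (rho : 'M[C]_(a * b * c)) : 'M[C]_b := ptrace_r (red_BC rho).

Definition cond_mutual_info {a b c} (rho : 'M[C]_(a * b * c)) : R :=
  vN_entropy (red_AB rho) + vN_entropy (red_BC rho)
  - vN_entropy (red_B rho) - vN_entropy rho.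

(* Quantum relative entropy D(rho||mu) = tr rho (log rho - log mu),
   equal to +oo unless supp rho is contained in supp mu
   (for psd matrices: ker mu is contained in ker rho). *)
Definition rel_entropy {n} (rho mu : 'M[C]_n) : \bar R :=
  if (kermx mu <= kermx rho)%MS
  then (complex.Re (\tr (rho *m (mxlog rho - mxlog mu))))%:E
  else +oo%E.

(* Isometric embedding of X (b^L b^R) Z into X Y Z, given the isometry
   W : b^L (x) b^R -> Y of one block of the decomposition of H_Y;
   the domain is ordered as (X b^L)(b^R Z). *)
Definition block_emb {x y z l r} (W : 'M[C]_(y, l * r)) :
    'M[C]_(x * y * z, (x * l) * (r * z)) :=
  \matrix_(u, v)
    let: (xy, c) := mxtens_unindex u in let: (a, b) := mxtens_unindex xy in
    let: (al, rc) := mxtens_unindex v in let: (a', i) := mxtens_unindex al in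
    let: (k, c') := mxtens_unindex rc in
    ((a == a') && (c == c'))%:R * W b (mxtens_index (i, k)).

(* quantum Markov state on X Y Z:
   H_Y = (+)_j b_j^L (x) b_j^R (orthogonal direct sum, given by isometries W_j
   with mutually orthogonal ranges summing to H_Y), probabilities p_j, states
   sigma_j on X b_j^L and tau_j on b_j^R Z, and
   mu = (+)_j p_j sigma_j (x) tau_j. *)
Definition markov_state {x y z} (mu : 'M[C]_(x * y * z)) : Prop :=
  exists (J : nat) (l r : 'I_J -> nat)
         (W : forall j : 'I_J, 'M[C]_(y, l j * r j))
         (p : 'I_J -> R)
         (sigma : forall j : 'I_J, 'M[C]_(x * l j))
         (tau : forall j : 'I_J, 'M[C]_(r j * z)),
    [/\ (forall j, isometry (W j)) /\
        (forall j k, j != k -> adj (W j) *m W k = 0),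
        \sum_(j < J) W j *m adj (W j) = 1%:M,
        (forall j, 0 <= p j) /\ \sum_(j < J) p j = 1,
        (forall j, is_state (sigma j) /\ is_state (tau j)) &
        mu = \sum_(j < J) ((p j)%:C%C *:
               (block_emb (W j) *m tensmx (sigma j) (tau j) *m adj (block_emb (W j))))].

Definition embed_state {a b c a' b' c'}
    (VA : 'M[C]_(a', a)) (VB : 'M[C]_(b', b)) (VC : 'M[C]_(c', c))
    (rho : 'M[C]_(a * b * c)) : 'M[C]_(a' * b' * c') :=
  let V := tensmx (tensmx VA VB) VC in V *m rho *m adj V.

Definition Delta {a b c} (rho : 'M[C]_(a * b * c)) : \bar R :=
  ereal_inf [set d : \bar R | exists (a' b' c' : nat)
      (VA : 'M[C]_(a', a)) (VB : 'M[C]_(b', b)) (VC : 'M[C]_(c', c))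
      (mu : 'M[C]_(a' * b' * c')),
      [/\ isometry VA, isometry VB, isometry VC, markov_state mu &
          d = rel_entropy (embed_state VA VB VC rho) mu]].

End Quantum.

(* Main.v *)
Require Import Defs.
From HB Require Import structures.
From mathcomp Require Import all_boot all_order all_algebra.
From mathcomp Require Import classical_sets reals ereal exp.
From mathcomp.real_closed Require Import complex mxtens.
From mathcomp Require Import sesquilinear spectral.
From mathcomp Require Import functions topology normedtype derive realfun.
From mathcomp Require Import ring lra.

(** Let [mu = (+)_j p_j sigma_j (x) tau_j] be a Markov state, and embed [B] into
    [L (x) N] with [L = (+)_j b_j^L] and [N = (+)_j b_j^R].  There [mu] is the
    restriction of a product [S (x) T] on [(A L)(N C)], with [S = (+)_j p_j sigma_j]
    and [T = (+)_j tau_j], so that [log mu] becomes [log S (x) 1 + 1 (x) log T].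
    With [s = tr_A S],
<<
      D(rho || mu) - I(A:C|B) = [ D(rho_AB || S (x) 1_N) - D(rho_B || s (x) 1_N) ]
                                + D(rho_BC || s (x) T).
>>
    The bracket is nonnegative by monotonicity of the relative entropy, and the last
    term by Klein's inequality, since [s (x) T] has trace one on the image of [B]
    (though not on [L N C]).  To have full-rank operators, [S] and [T] are replaced
    by [S + eps] and [T + eps], with [eps] tending to zero.

    Monotonicity rests on [log r - log s = \int_0^oo (r / (t r + s) - 1 / (1 + t)) dt]
    and on the variational formula, over operators [Y],
<<
      \sum_ij |<i|j>|^2 r_i^2 / (t r_i + s_j)
        = sup_Y 2 Re tr(rho Y) - t tr(rho Y Y^* ) - tr(K Y^* Y),
>>
    whose right-hand side can only decrease when [Y] is restricted to [1 (x) Y_B]. *)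

Local Open Scope ring_scope.

Set Implicit Arguments.
Unset Strict Implicit.
Unset Printing Implicit Defensive.

Import Order.TTheory GRing.Theory Num.Theory numFieldNormedType.Exports.

(** * Adjoints, traces and spectral resolutions *)

Section Adjoint.
Variable R : realType.
Local Notation C := (R[i]).

Lemma adjE m n (A : 'M[C]_(m, n)) i j : adj A i j = Num.conj (A j i).
Proof. by rewrite !mxE. Qed.

Lemma adjK m n (A : 'M[C]_(m, n)) : adj (adj A) = A.
Proof. by apply/matrixP=> i j; rewrite !adjE conjCK. Qed.

Lemma adjM m n p (A : 'M[C]_(m, n)) (B : 'M[C]_(n, p)) :
  adj (A *m B) = adj B *m adj A.
Proof. by rewrite /adj trmx_mul map_mxM. Qed.

Lemma adjD m n (A B : 'M[C]_(m, n)) : adj (A + B) = adj A + adj B.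
Proof. by rewrite /adj linearD map_mxD. Qed.

Lemma adj0 m n : adj (0 : 'M[C]_(m, n)) = 0.
Proof. by rewrite /adj trmx0 map_mx0. Qed.

Lemma adj1 n : adj (1%:M : 'M[C]_n) = 1%:M.
Proof. by rewrite /adj trmx1 map_mx1. Qed.

Lemma conj_realC (r : R) : Num.conj (r%:C%C) = r%:C%C.
Proof. by rewrite -[LHS]/(conjc _) conjc_real. Qed.

Lemma adjZ m n (r : R) (A : 'M[C]_(m, n)) : adj (r%:C%C *: A) = r%:C%C *: adj A.
Proof. by apply/matrixP=> i j; rewrite adjE !mxE rmorphM /= conj_realC. Qed.

Lemma adjB m n (A B : 'M[C]_(m, n)) : adj (A - B) = adj A - adj B.
Proof. by apply/matrixP=> i j; rewrite adjE !mxE rmorphB. Qed.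

Lemma adj_sum m n (I : finType) (P : pred I) (F : I -> 'M[C]_(m, n)) :
  adj (\sum_(i | P i) F i) = \sum_(i | P i) adj (F i).
Proof. by apply: (big_morph (@adj R m n) (@adjD m n) (@adj0 m n)). Qed.

Lemma adj_tens m n p q (A : 'M[C]_(m, n)) (B : 'M[C]_(p, q)) :
  adj (tensmx A B) = tensmx (adj A) (adj B).
Proof. by rewrite /adj trmx_tens map_mxT. Qed.

Lemma trC_conj n (A : 'M[C]_n) : \tr (adj A) = Num.conj (\tr A).
Proof. by rewrite /mxtrace rmorph_sum; apply: eq_bigr=> i _; rewrite adjE. Qed.

Lemma mulmx_adj_ge0 m n (M : 'M[C]_(m, n)) : 0 <= \tr (M *m adj M).
Proof.
apply: sumr_ge0=> i _; rewrite mxE; apply: sumr_ge0=> k _.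
by rewrite adjE mul_conjC_ge0.
Qed.

(** Taking the real part keeps all inequalities in [R], even for the non-Hermitian operators of the
    variational formula, and the result is invariant under the adjoint. *)
Definition rtr n (A : 'M[C]_n) : R := complex.Re (\tr A).

Lemma ReD (x y : C) : complex.Re (x + y) = complex.Re x + complex.Re y.
Proof. by case: x y => [a b] []. Qed.

Lemma ReZ (r : R) (x : C) : complex.Re (r%:C%C * x) = r * complex.Re x.
Proof. by case: x => a b /=; rewrite mul0r subr0. Qed.

Lemma Re_conj (x : C) : complex.Re (Num.conj x) = complex.Re x.
Proof. by case: x. Qed.

Lemma Re_ge0 (x : C) : 0 <= x -> 0 <= complex.Re x.
Proof. by rewrite lecE => /andP[]. Qed.

Lemma rtrD n (A B : 'M[C]_n) : rtr (A + B) = rtr A + rtr B.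
Proof. by rewrite /rtr mxtraceD ReD. Qed.

Lemma rtr0 n : rtr (0 : 'M[C]_n) = 0.
Proof. by rewrite /rtr mxtrace0. Qed.

Lemma rtrZ n (r : R) (A : 'M[C]_n) : rtr (r%:C%C *: A) = r * rtr A.
Proof. by rewrite /rtr mxtraceZ ReZ. Qed.

Lemma rtrN n (A : 'M[C]_n) : rtr (- A) = - rtr A.
Proof. by apply/eqP; rewrite -subr_eq0 opprK addrC -rtrD subrr rtr0. Qed.

Lemma rtrB n (A B : 'M[C]_n) : rtr (A - B) = rtr A - rtr B.
Proof. by rewrite rtrD rtrN. Qed.

Lemma rtr_sum n (I : finType) (P : pred I) (F : I -> 'M[C]_n) :
  rtr (\sum_(i | P i) F i) = \sum_(i | P i) rtr (F i).
Proof. by apply: (big_morph (@rtr n) (@rtrD n) (@rtr0 n)). Qed.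

Lemma rtrC m n (A : 'M[C]_(m, n)) (B : 'M[C]_(n, m)) : rtr (A *m B) = rtr (B *m A).
Proof. by rewrite /rtr mxtrace_mulC. Qed.

Lemma rtr_adj n (A : 'M[C]_n) : rtr (adj A) = rtr A.
Proof. by rewrite /rtr trC_conj Re_conj. Qed.

(** The two cross terms are adjoint to each other, hence have the same real trace. This expansion of
    a squared Hilbert-Schmidt norm serves to complete the square in [qform_term]. *)
Lemma rtr_normB m n (d r : R) (Z M : 'M[C]_(m, n)) (D := d%:C%C *: Z - r%:C%C *: M) :
  rtr (D *m adj D) = d ^+ 2 * rtr (Z *m adj Z) - 2 * (d * r * rtr (Z *m adj M)) +
    r ^+ 2 * rtr (M *m adj M).
Proof.
have MZ : rtr (M *m adj Z) = rtr (Z *m adj M) by rewrite -rtr_adj adjM adjK.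
have combine (a b c e : 'M[C]_m) :
    rtr (d%:C%C *: (d%:C%C *: a) - d%:C%C *: (r%:C%C *: b) -
      (r%:C%C *: (d%:C%C *: c) - r%:C%C *: (r%:C%C *: e))) =
    d * (d * rtr a) - d * (r * rtr b) - (r * (d * rtr c) - r * (r * rtr e)).
  by rewrite [LHS]rtrB; congr (_ - _); rewrite [LHS]rtrB !rtrZ.
rewrite /D adjB !adjZ mulmxBl !mulmxBr -!scalemxAl -!scalemxAr.
rewrite combine MZ.
by move: (rtr _) (rtr _) (rtr _) => x y z; ring.
Qed.

Lemma psdmx_adj n (A : 'M[C]_n) : psdmx A -> adj A = A.
Proof. by case. Qed.

(** Each diagonal entry of [M *m A *m adj M] is the quadratic form of [A] at a row of [M]. *)
Lemma psdmx_conj_tr_ge0 m n (A : 'M[C]_n) (M : 'M[C]_(m, n)) :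
  psdmx A -> 0 <= \tr (M *m A *m adj M).
Proof.
move=> [_ Ap]; apply: sumr_ge0=> i _.
have := Ap (row i M).
suff -> : (row i M *m A *m adj (row i M)) 0 0 = (M *m A *m adj M) i i by [].
rewrite -row_mul [LHS]mxE [RHS]mxE.
by apply: eq_bigr => k _; congr (_ * _); rewrite ?adjE !mxE.
Qed.

Lemma psdmx_conj_rtr_ge0 m n (A : 'M[C]_n) (M : 'M[C]_(m, n)) :
  psdmx A -> 0 <= rtr (M *m A *m adj M).
Proof. by move=> Ap; apply/Re_ge0/psdmx_conj_tr_ge0. Qed.

Lemma psdmxP n (A : 'M[C]_n) : adj A = A ->
  (forall v : 'rV[C]_n, 0 <= \tr (v *m A *m adj v)) -> psdmx A.
Proof. by move=> Ah Ap; split=> // v; have := Ap v; rewrite trace_mx11. Qed.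

Lemma psdmx_conj m n (A : 'M[C]_n) (M : 'M[C]_(m, n)) :
  psdmx A -> psdmx (M *m A *m adj M).
Proof.
move=> Ap; apply: psdmxP; first by rewrite !adjM adjK (psdmx_adj Ap) mulmxA.
by move=> v; have := psdmx_conj_tr_ge0 (v *m M) Ap; rewrite adjM !mulmxA.
Qed.

Lemma psdmx_sum n (I : finType) (P : pred I) (F : I -> 'M[C]_n) :
  (forall i, P i -> psdmx (F i)) -> psdmx (\sum_(i | P i) F i).
Proof.
move=> Fp; apply: psdmxP.
  by rewrite adj_sum; apply: eq_bigr=> i /Fp /psdmx_adj.
move=> v; rewrite mulmx_sumr mulmx_suml raddf_sum.
by apply: sumr_ge0=> i /Fp; apply: psdmx_conj_tr_ge0.
Qed.

Lemma psdmxZ n (r : R) (A : 'M[C]_n) : 0 <= r -> psdmx A -> psdmx (r%:C%C *: A).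
Proof.
move=> r0 Ap; apply: psdmxP; first by rewrite adjZ (psdmx_adj Ap).
move=> v; rewrite -scalemxAr -scalemxAl mxtraceZ mulr_ge0 ?ler0c //.
exact: psdmx_conj_tr_ge0.
Qed.

End Adjoint.

(** * Resolutions of the identity and functional calculus *)

Section Resolution.
Variable R : realType.
Local Notation C := (R[i]).

(** The projections may have any rank and may vanish, so that images under homomorphisms and
    products of commuting families are again resolutions. *)
Definition resolution n (I : finType) (E : I -> 'M[C]_n) : Prop :=
  [/\ forall i, adj (E i) = E i,
      forall i j, E i *m E j = if i == j then E i else 0 &
      \sum_i E i = 1%:M].

(** The values [d] may repeat; a function [f] of this operator is [spec E (fun i => f (d i))]. *)
Definition spec n (I : finType) (E : I -> 'M[C]_n) (d : I -> R) : 'M[C]_n :=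
  \sum_i (d i)%:C%C *: E i.

Section OneResolution.
Variables (n : nat) (I : finType) (E : I -> 'M[C]_n).
Hypothesis Eres : resolution E.

Lemma res_adj i : adj (E i) = E i. Proof. by case: Eres. Qed.

Lemma res_sum : \sum_i E i = 1%:M. Proof. by case: Eres. Qed.

Lemma resM i j : E i *m E j = if i == j then E i else 0.
Proof. by case: Eres. Qed.

Lemma resK i : E i *m E i = E i.
Proof. by rewrite resM eqxx. Qed.

Lemma res_psd i : psdmx (E i).
Proof.
apply: psdmxP => [|v]; first exact: res_adj.
by have := mulmx_adj_ge0 (v *m E i); rewrite adjM res_adj -mulmxA (mulmxA (E i)) resK mulmxA.
Qed.

Lemma res_spec d i : E i *m spec E d = (d i)%:C%C *: E i.
Proof.
rewrite mulmx_sumr (bigD1 i) //= -scalemxAr resK big1 ?addr0 // => j ji.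
by rewrite -scalemxAr resM eq_sym (negPf ji) scaler0.
Qed.

Lemma spec_res d i : spec E d *m E i = (d i)%:C%C *: E i.
Proof.
rewrite mulmx_suml (bigD1 i) //= -scalemxAl resK big1 ?addr0 // => j ji.
by rewrite -scalemxAl resM (negPf ji) scaler0.
Qed.

Lemma spec_cst (r : R) : spec E (fun=> r) = r%:C%C%:M.
Proof. by rewrite /spec -scaler_sumr res_sum scalemx1. Qed.

Lemma res_rtr_ge0 m (A : 'M[C]_m) (V : 'M[C]_(m, n)) i :
  psdmx A -> 0 <= rtr (A *m (V *m E i *m adj V)).
Proof.
move=> Ap; have := psdmx_conj_rtr_ge0 (E i *m adj V) Ap.
by rewrite adjM adjK res_adj rtrC !mulmxA -(mulmxA V) resK rtrC !mulmxA.
Qed.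

End OneResolution.

Lemma specD n (I : finType) (E : I -> 'M[C]_n) d e :
  spec E (fun i => d i + e i) = spec E d + spec E e.
Proof. by rewrite -big_split; apply: eq_bigr=> i _; rewrite rmorphD scalerDl. Qed.

Lemma eq_spec n (I : finType) (E : I -> 'M[C]_n) d e :
  d =1 e -> spec E d = spec E e.
Proof. by move=> de; apply: eq_bigr=> i _; rewrite de. Qed.

(** Sandwiching the hypothesis between [E i] and [G j] shows that the block [E i *m V *m G j]
    vanishes unless [d i = e j], so [f] of either value may be used on it. *)
Lemma spec_intertwine m n (I J : finType) (E : I -> 'M[C]_m) (G : J -> 'M[C]_n)
    (d : I -> R) (e : J -> R) (V : 'M[C]_(m, n)) (f : R -> R) :
  resolution E -> resolution G -> spec E d *m V = V *m spec G e ->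
  spec E (fun i => f (d i)) *m V = V *m spec G (fun j => f (e j)).
Proof.
move=> Er Gr dV.
have key i j : (f (d i))%:C%C *: (E i *m V *m G j) = (f (e j))%:C%C *: (E i *m V *m G j).
  have : E i *m (spec E d *m V) *m G j = E i *m (V *m spec G e) *m G j by rewrite dV.
  rewrite !mulmxA res_spec // -!scalemxAl -(mulmxA _ (spec G e)) spec_res // -scalemxAr.
  move/eqP; rewrite -subr_eq0 -scalerBl scaler_eq0 subr_eq0 => /orP[/eqP[->//]|/eqP ->].
  by rewrite !scaler0.
rewrite -[LHS]mulmx1 -(res_sum Gr) -[RHS]mul1mx -(res_sum Er).
rewrite /spec !mulmx_suml.
under eq_bigr => i _ do rewrite mulmx_sumr.
under [RHS]eq_bigr => i _ do rewrite !mulmx_sumr.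
apply: eq_bigr=> i _; apply: eq_bigr=> j _.
by rewrite -!scalemxAl key -!scalemxAr mulmxA.
Qed.

(** These joint spectral projections let the logarithm of a product of commuting operators be
    computed as a sum of logarithms. *)
Lemma commuting_resolution n (I J : finType) (E : I -> 'M[C]_n) (F : J -> 'M[C]_n) :
  resolution E -> resolution F -> (forall i j, E i *m F j = F j *m E i) ->
  resolution (fun ij : I * J => E ij.1 *m F ij.2).
Proof.
move=> Er Fr EF; split=> [[i j]|[i j] [k l]|] /=.
- by rewrite adjM !(res_adj Er, res_adj Fr) EF.
- rewrite -mulmxA (mulmxA (F j)) -EF -mulmxA mulmxA (resM Er) (resM Fr) xpair_eqE.
  by case: eqP => _; case: eqP => _; rewrite ?mul0mx ?mulmx0.
- rewrite -(pair_bigA _ (fun i j => E i *m F j)) /=.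
  under eq_bigr => i _ do rewrite -mulmx_sumr (res_sum Fr) mulmx1.
  exact: res_sum.
Qed.

Lemma spec_commutingD n (I J : finType) (E : I -> 'M[C]_n) (F : J -> 'M[C]_n) d e :
  resolution E -> resolution F ->
  spec (fun ij : I * J => E ij.1 *m F ij.2) (fun ij => d ij.1 + e ij.2) =
    spec E d + spec F e.
Proof.
move=> Er Fr; rewrite specD; congr (_ + _).
- rewrite /spec -(pair_bigA _ (fun i j => (d i)%:C%C *: (E i *m F j))) /=.
  apply: eq_bigr=> i _; rewrite -scaler_sumr.
  by rewrite -mulmx_sumr (res_sum Fr) mulmx1.
- rewrite /spec -(pair_bigA _ (fun i j => (e j)%:C%C *: (E i *m F j))) /= exchange_big /=.
  apply: eq_bigr=> i _; rewrite -scaler_sumr.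
  by rewrite -mulmx_suml (res_sum Er) mul1mx.
Qed.

Lemma spec_commutingM n (I J : finType) (E : I -> 'M[C]_n) (F : J -> 'M[C]_n) d e :
  spec (fun ij : I * J => E ij.1 *m F ij.2) (fun ij => d ij.1 * e ij.2) =
    spec E d *m spec F e.
Proof.
rewrite /spec -(pair_bigA _ (fun i j => (d i * e j)%:C%C *: (E i *m F j))) /=.
rewrite mulmx_suml; apply: eq_bigr=> i _; rewrite mulmx_sumr; apply: eq_bigr=> j _.
by rewrite -scalemxAl -scalemxAr scalerA rmorphM.
Qed.

(** The bridge from [mxlog] to the functional calculus: the projections are those on the rows of the
    diagonalising unitary. Since [ln 0 = 0], the logarithm vanishes on the kernel. *)
Lemma spectral_resolution n (A : 'M[C]_n) : adj A = A ->
  exists (E : 'I_n -> 'M[C]_n) (d : 'I_n -> R),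
    [/\ resolution E, A = spec E d, mxlog A = spec E (fun i => ln (d i)) &
        psdmx A -> forall i, 0 <= d i].
Proof.
move=> Ah.
have Aherm : A \is hermsymmx.
  by apply/is_hermitianmxP; rewrite expr0 scale1r -[LHS]Ah; apply/matrixP=> i j; rewrite !mxE.
have /orthomx_spectralP AE := hermitian_normalmx Aherm.
have dreal := hermitian_spectral_diag_real Aherm.
pose P := spectralmx A.
have PU : P \is unitarymx by exact: spectral_unitarymx.
have PV : invmx P = adj P by rewrite invmx_unitary //; apply/matrixP=> i j; rewrite !mxE.
have PP : P *m adj P = 1%:M by rewrite -PV mulmxV // unitarymx_unit.
have PP' : adj P *m P = 1%:M by rewrite -PV mulVmx // unitarymx_unit.
pose E (i : 'I_n) : 'M[C]_n := adj P *m delta_mx i i *m P.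
pose d (i : 'I_n) : R := complex.Re (spectral_diag A 0 i).
have adjdelta (i : 'I_n) : adj (delta_mx i i : 'M[C]_n) = delta_mx i i.
  apply/matrixP=> k l; rewrite adjE !mxE andbC.
  by case: andP; rewrite ?conjC1 ?conjC0.
have diagE (x : 'rV[C]_n) : adj P *m diag_mx x *m P = \sum_i x 0 i *: E i.
  rewrite (_ : diag_mx x = \sum_i x 0 i *: delta_mx i i).
    rewrite mulmx_sumr mulmx_suml; apply: eq_bigr=> i _.
    by rewrite -scalemxAr -scalemxAl.
  apply/matrixP=> k l; rewrite summxE (bigD1 k) //= big1 ?addr0 => [|i ik].
    by rewrite !mxE eqxx /= [l == k]eq_sym mulr_natr.
  by rewrite !mxE [k == i]eq_sym (negPf ik) mulr0.
have dE i : (d i)%:C%C = spectral_diag A 0 i.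
  by rewrite /d RRe_real //; apply: (mxOverP dreal).
exists E, d; split.
- split=> [i|i j|].
  + by rewrite /E [LHS]adjM [X in _ *m X]adjM adjK adjdelta; apply: mulmxA.
  + rewrite /E -!mulmxA (mulmxA P) PP mul1mx (mulmxA (delta_mx i i)) mul_delta_mx_cond.
    by case: eqP => [->|_]; rewrite ?mulr1n ?mulr0n ?mul0mx ?mulmx0.
  + have := diagE (const_mx 1); rewrite diag_const_mx mulmx1 PP' => ->.
    by apply: eq_bigr=> i _; rewrite mxE scale1r; apply: erefl.
- rewrite {1}AE -/P PV diagE.
  by apply: eq_bigr=> i _; rewrite dE.
- rewrite /mxlog -/P PV diagE.
  by apply: eq_bigr=> i _; rewrite !mxE.
(* The eigenvalue [d i] is the quadratic form of [A] at row [i] of [P]. *)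
- move=> Ap i; have := psdmx_conj_rtr_ge0 (row i P) Ap.
  suff -> : rtr (row i P *m A *m adj (row i P)) = d i by [].
  have -> : row i P *m A *m adj (row i P) = ((P *m A *m adj P) i i)%:M.
    apply/matrixP=> k l; rewrite (ord1 k) (ord1 l) -row_mul [LHS]mxE !mxE eqxx mulr1n.
    by apply: eq_bigr => j _; congr (_ * _); rewrite !mxE.
  rewrite AE -/P PV !mulmxA PP mul1mx -mulmxA PP mulmx1 mxE eqxx mulr1n.
  by rewrite /rtr mxtrace_scalar mulr1n.
Qed.

End Resolution.

(** * Monotonicity of the relative entropy *)

Section Scalar.
Variable R : realType.

Lemma ln_linear_is_derive (a r s x : R) : 0 <= r -> 0 < s -> 0 <= x ->
  is_derive x 1 (fun t : R => a * ln (t * r + s)) (a * (r / (x * r + s))).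
Proof.
move=> r0 s0 x0.
have pos : 0 < x * r + s by rewrite ltr_wpDl // mulr_ge0.
have d1 : is_derive x 1 (fun t : R => t * r + s) r.
  apply: is_derive_eq.
  by rewrite scaler0 add0r addr0 /GRing.scale /= mulr1.
have dln := is_derive1_ln pos.
have d2 := @is_derive1_comp R (fun u : R => ln u) (fun t : R => t * r + s) x _ _ dln d1.
apply: is_derive_eq.
by rewrite /GRing.scale /=; ring.
Qed.

(* The left-hand side of the hypothesis is the derivative at [t] of
   [\sum_k c k * r k * ln (t * r k + s k)], which is thus monotone; the two
   sides of the conclusion are its limits at [0] and at infinity. *)
Lemma ln_sum_le (K : finType) (c r s : K -> R) :
    (forall k, 0 <= r k) -> (forall k, 0 < s k) -> \sum_k c k * r k = 0 ->
    (forall t, 0 < t -> 0 <= \sum_k c k * (r k ^+ 2 / (t * r k + s k))) ->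
  \sum_k c k * (r k * ln (s k)) <= \sum_k c k * (r k * ln (r k)).
Proof.
move=> r0 s0 cr0 dpos.
pose H (t : R) := \sum_k c k * (r k * ln (t * r k + s k)).
pose dH (t : R) := \sum_k c k * (r k ^+ 2 / (t * r k + s k)).
have Hd (t : R) : 0 <= t -> is_derive t 1 H (dH t).
  move=> t0; rewrite /H /dH.
  have -> : (fun t => \sum_k c k * (r k * ln (t * r k + s k))) =
      \sum_k (fun t => c k * r k * ln (t * r k + s k)).
    by apply/boolp.funext=> u; rewrite fct_sumE; apply: eq_bigr=> k _; rewrite mulrA.
  have -> : \sum_k c k * (r k ^+ 2 / (t * r k + s k)) =
      \sum_k c k * r k * (r k / (t * r k + s k)).
    by apply: eq_bigr=> k _; rewrite expr2 !mulrA.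
  apply: (big_ind2 (fun f df => is_derive t (1 : R) (f : R -> R) (df : R))) => [||k _].
  - exact: is_derive_cst.
  - by move=> *; apply: is_deriveD.
  - exact: ln_linear_is_derive.
have Hincr (T : R) : 0 < T -> H 0 <= H T.
  move=> T0.
  have [x||x] := @MVT R H dH 0 T T0.
  - by rewrite in_itv /= => /andP[/ltW x0 _]; apply: Hd.
  - apply: derivable_within_continuous => x; rewrite in_itv /= => /andP[x0 _].
    by have [] := Hd x x0.
  rewrite in_itv /= => /andP[x0 _] HT.
  by rewrite -subr_ge0 HT subr0 mulr_ge0 ?(ltW T0) // dpos.
(* The error constant for large [T]: [ln (T * r k + s k)] splits into [ln T], [ln (r k)] and
   [ln (1 + s k / (T * r k))], and the last is at most [s k / (T * r k)]. *)
pose D := \sum_k `|c k| * s k.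
have D0 : 0 <= D by apply: sumr_ge0=> k _; rewrite mulr_ge0 // ltW.
have Hup (T : R) : 0 < T -> H T <= \sum_k c k * (r k * ln (r k)) + D / T.
  move=> T0.
  (* Inserting [ln T] changes nothing because the weights [c k * r k] sum to zero. *)
  have -> : \sum_k c k * (r k * ln (r k)) =
      \sum_k c k * (r k * (ln T + ln (r k))).
    under [RHS]eq_bigr => k _ do rewrite mulrDr mulrDr mulrA.
    by rewrite big_split /= -mulr_suml cr0 mul0r add0r.
  rewrite mulr_suml -big_split /=; apply: ler_sum=> k _.
  have [->|rk] := eqVneq (r k) 0.
    by rewrite !mul0r !mulr0 add0r !mulr_ge0 ?invr_ge0 // ltW.
  have rk0 : 0 < r k by rewrite lt_neqAle eq_sym rk r0.
  have Trk : 0 < T * r k by rewrite mulr_gt0.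
  have q0 : 0 < s k / (T * r k) by rewrite divr_gt0.
  have -> : T * r k + s k = T * r k * (1 + s k / (T * r k)).
    by field; rewrite rk (gt_eqF T0).
  have e0 : 0 < 1 + s k / (T * r k) by rewrite addr_gt0.
  rewrite !lnM ?posrE // 2!mulrDr lerD2l.
  have l0 : 0 <= ln (1 + s k / (T * r k)) by rewrite ln_ge0 // lerDl ltW.
  apply: (@le_trans _ _ (`|c k| * (r k * ln (1 + s k / (T * r k))))).
    by rewrite ler_wpM2r ?ler_norm // mulr_ge0.
  have -> : `|c k| * s k / T = `|c k| * (r k * (s k / (T * r k))).
    by field; rewrite rk (gt_eqF T0).
  rewrite !ler_wpM2l //; apply: le_ln1Dx.
  by rewrite (lt_trans _ q0) // oppr_lt0.
have H0 : H 0 = \sum_k c k * (r k * ln (s k)).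
  by apply: eq_bigr=> k _; rewrite mul0r add0r.
rewrite -H0; apply/ler_addgt0Pr => e e0.
(* This makes [D / T] at most [e]; the added 1 keeps [T] positive when [D] is zero. *)
pose T := (D + 1) / e.
have T0 : 0 < T by rewrite divr_gt0 // ltr_wpDl.
apply: le_trans (Hincr _ T0) (le_trans (Hup _ T0) _).
rewrite lerD2l ler_pdivrMr // /T mulrC divfK ?gt_eqF //.
by rewrite lerDl.
Qed.

(** The scalar case of Klein's inequality: [ln u <= u - 1] at [u = y / x]. *)
Lemma ln_ge_1sub (x y : R) : 0 < x -> 0 < y -> x - y <= x * (ln x - ln y).
Proof.
move=> x0 y0.
have q0 : 0 < y / x by rewrite divr_gt0.
have : ln (1 + (y / x - 1)) <= y / x - 1.
  by apply: le_ln1Dx; rewrite ltrBrDl subrr.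
rewrite addrC subrK lnM ?posrE ?invr_gt0 // lnV ?posrE //.
rewrite -(ler_pM2l x0) => h.
have -> : x - y = - (x * (y / x - 1)) by field; rewrite gt_eqF.
by rewrite -[ln x - _]opprB mulrN lerN2.
Qed.

End Scalar.

(** * Relative entropy expanded over two resolutions *)

Section RelativeEntropy.
Variable R : realType.
Local Notation C := (R[i]).

Lemma rtr_spec n (I : finType) (E : I -> 'M[C]_n) d (B : 'M[C]_n) :
  rtr (spec E d *m B) = \sum_i d i * rtr (E i *m B).
Proof.
rewrite /spec mulmx_suml rtr_sum; apply: eq_bigr=> i _.
by rewrite -scalemxAl rtrZ.
Qed.

Section Overlap.
Variables (n : nat) (I J : finType) (E : I -> 'M[C]_n) (G : J -> 'M[C]_n).
Hypotheses (Er : resolution E) (Gr : resolution G).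

(** For rank-one projections this is the squared modulus of the inner product of the two unit
    vectors. *)
Definition overlap (ij : I * J) : R := rtr (E ij.1 *m G ij.2).

Lemma rtr_insert_right (A : 'M[C]_n) : rtr A = \sum_j rtr (A *m G j).
Proof. by rewrite -rtr_sum -mulmx_sumr (res_sum Gr) mulmx1. Qed.

Lemma rtr_overlap i j : rtr (E i *m G j *m adj (E i *m G j)) = overlap (i, j).
Proof.
rewrite adjM (res_adj Er) (res_adj Gr) !mulmxA -(mulmxA (E i)) (resK Gr).
by rewrite rtrC mulmxA (resK Er).
Qed.

Lemma rtr_spec_spec d e :
  rtr (spec E d *m spec G e) = \sum_ij overlap ij * (d ij.1 * e ij.2).
Proof.
rewrite -(pair_bigA _ (fun i j => overlap (i, j) * (d i * e j))) /= rtr_spec.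
apply: eq_bigr=> i _; rewrite rtrC rtr_spec mulr_sumr.
by apply: eq_bigr=> j _; rewrite rtrC -/(overlap (i, j)); ring.
Qed.

Lemma rtr_specl d : rtr (spec E d) = \sum_ij overlap ij * d ij.1.
Proof.
rewrite -[LHS](congr1 (@rtr R n) (mulmx1 _)) -(_ : spec G (fun=> 1) = 1%:M).
  by rewrite rtr_spec_spec; apply: eq_bigr=> ij _; rewrite mulr1.
by rewrite spec_cst.
Qed.

End Overlap.

(** Both traces are expanded over the same pairs of projections, the form that [ln_sum_le]
    compares. *)
Lemma relative_entropy_spec n (I J : finType) (E : I -> 'M[C]_n) (G : J -> 'M[C]_n) r s :
  resolution E -> resolution G ->
  rtr (spec E r *m spec E (fun i => ln (r i))) - rtr (spec E r *m spec G (fun j => ln (s j))) =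
    \sum_ij overlap E G ij * (r ij.1 * ln (r ij.1)) -
    \sum_ij overlap E G ij * (r ij.1 * ln (s ij.2)).
Proof.
move=> Er Gr; rewrite [X in _ - X = _]rtr_spec_spec; congr (_ - _).
rewrite -(rtr_specl E Gr (fun i => r i * ln (r i))); congr (rtr _).
rewrite {1}/spec mulmx_suml; apply: eq_bigr=> i _.
by rewrite -scalemxAl res_spec // scalerA rmorphM.
Qed.

(* The quadratic functional whose supremum over [Y] is
   [\sum_ij overlap ij * (r i ^+ 2 / (t * r i + s j))]. *)
Definition qform n (rho K : 'M[C]_n) (t : R) (Y : 'M[C]_n) : R :=
  2 * rtr (rho *m Y) - t * rtr (rho *m (Y *m adj Y)) - rtr (K *m (adj Y *m Y)).

Section Variational.
Variables (n : nat) (I J : finType) (E : I -> 'M[C]_n) (G : J -> 'M[C]_n).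
Variables (r : I -> R) (s : J -> R) (t : R).
Hypotheses (Er : resolution E) (Gr : resolution G).
Hypotheses (r0 : forall i, 0 <= r i) (s0 : forall j, 0 < s j) (t0 : 0 < t).

Local Notation den ij := (t * r ij.1 + s ij.2).
Local Notation bound :=
  (\sum_ij overlap E G ij * (r ij.1 ^+ 2 / den ij)).

Let den_gt0 (ij : I * J) : 0 < den ij.
Proof. by rewrite ltr_wpDl // mulr_ge0 // ltW. Qed.

(** Inserting the resolutions on the two sides of [Y] decouples the functional into the blocks
    [E i *m Y *m G j], which can be optimised separately. *)
Lemma qform_expand Y : qform (spec E r) (spec G s) t Y =
  \sum_ij (2 * (r ij.1 * rtr (E ij.1 *m Y *m G ij.2)) -
    den ij * rtr (E ij.1 *m Y *m G ij.2 *m adj (E ij.1 *m Y *m G ij.2))).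
Proof.
pose Z i j := E i *m Y *m G j.
have ZZ1 i j : rtr (Z i j *m adj (Z i j)) = rtr (E i *m (Y *m (G j *m adj Y))).
  rewrite /Z !adjM (res_adj Er) (res_adj Gr) !mulmxA -(mulmxA _ (G j) (G j)) (resK Gr).
  by rewrite rtrC !mulmxA (resK Er).
have e1 : rtr (spec E r *m Y) = \sum_i \sum_j r i * rtr (Z i j).
  rewrite rtr_spec; apply: eq_bigr=> i _.
  by rewrite (rtr_insert_right Gr) mulr_sumr.
have e2 : rtr (spec E r *m (Y *m adj Y)) = \sum_i \sum_j r i * rtr (Z i j *m adj (Z i j)).
  rewrite rtr_spec; apply: eq_bigr=> i _; rewrite -mulr_sumr; congr (_ * _).
  under eq_bigr => j _ do rewrite ZZ1.
  by rewrite -rtr_sum -!mulmx_sumr -mulmx_suml (res_sum Gr) mul1mx.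
have e3 : rtr (spec G s *m (adj Y *m Y)) = \sum_i \sum_j s j * rtr (Z i j *m adj (Z i j)).
  rewrite exchange_big rtr_spec; apply: eq_bigr=> j _; rewrite -mulr_sumr; congr (_ * _).
  under eq_bigr => i _ do rewrite ZZ1 rtrC.
  rewrite -rtr_sum -mulmx_sumr (res_sum Er) mulmx1 [RHS]rtrC.
  by rewrite mulmxA.
rewrite /qform e1 e2 e3 -[RHS](pair_bigA _ (fun i j => 2 * (r i * rtr (Z i j)) -
  (t * r i + s j) * rtr (Z i j *m adj (Z i j)))) /=.
rewrite !mulr_sumr -!sumrB; apply: eq_bigr=> i _.
rewrite !mulr_sumr -!sumrB; apply: eq_bigr=> j _.
by ring.
Qed.

(** Completing the square in one block: the maximum is attained when the block is a multiple of
    [E i *m G j], whose squared norm is the overlap. *)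
Lemma qform_term Y ij (M := E ij.1 *m G ij.2) (Z := E ij.1 *m Y *m G ij.2)
    (D := (den ij)%:C%C *: Z - (r ij.1)%:C%C *: M) :
  2 * (r ij.1 * rtr Z) - den ij * rtr (Z *m adj Z) =
  overlap E G ij * (r ij.1 ^+ 2 / den ij) - rtr (D *m adj D) / den ij.
Proof.
have ZM : rtr (Z *m adj M) = rtr Z.
  rewrite /Z /M adjM (res_adj Er) (res_adj Gr) !mulmxA -(mulmxA _ (G _) (G _)) (resK Gr).
  by rewrite rtrC !mulmxA (resK Er).
have MM : rtr (M *m adj M) = overlap E G ij by rewrite /M rtr_overlap -?surjective_pairing.
by rewrite rtr_normB ZM MM; field; rewrite gt_eqF.
Qed.

Lemma qform_le Y : qform (spec E r) (spec G s) t Y <= bound.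
Proof.
rewrite qform_expand; apply: ler_sum=> ij _; rewrite qform_term gerBl.
by apply: divr_ge0; [apply/Re_ge0/mulmx_adj_ge0 | apply/ltW].
Qed.

Lemma qform_attained : exists Y, qform (spec E r) (spec G s) t Y = bound.
Proof.
(* The optimiser: its coefficients make every completed square vanish. *)
pose Y := \sum_(ij : I * J) (r ij.1 / den ij)%:C%C *: (E ij.1 *m G ij.2).
exists Y; rewrite qform_expand; apply: eq_bigr=> -[i j] _; rewrite qform_term.
have -> : E i *m Y *m G j = (r i / (t * r i + s j))%:C%C *: (E i *m G j).
  rewrite /Y mulmx_sumr mulmx_suml (bigD1 (i, j)) //= big1 ?addr0 => [|[k l]] /=.
    by rewrite -scalemxAr -scalemxAl mulmxA (resK Er) -mulmxA (resK Gr).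
  rewrite xpair_eqE => kl.
  rewrite -scalemxAr -scalemxAl mulmxA (resM Er) -mulmxA.
  move: kl; have [->|ki] := eqVneq i k; last by rewrite mul0mx scaler0.
  move=> /= lj; rewrite (resM Gr) (negPf lj) mulmx0.
  by rewrite scaler0.
have e : (t * r i + s j) * (r i / (t * r i + s j)) = r i.
  by rewrite mulrCA divff ?mulr1 // gt_eqF // (den_gt0 (i, j)).
rewrite scalerA -rmorphM /= e.
by rewrite subrr mul0mx rtr0 mul0r subr0.
Qed.

End Variational.

Section Monotonicity.
Variables (n m : nat) (I J I' J' : finType).
Variables (E : I -> 'M[C]_n) (G : J -> 'M[C]_n) (r : I -> R) (s : J -> R).
Variables (E' : I' -> 'M[C]_m) (G' : J' -> 'M[C]_m) (r' : I' -> R) (s' : J' -> R).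
Variable T : 'M[C]_m -> 'M[C]_n.
Hypotheses (Er : resolution E) (Gr : resolution G).
Hypotheses (Er' : resolution E') (Gr' : resolution G').
Hypotheses (r0 : forall i, 0 <= r i) (s0 : forall j, 0 < s j).
Hypotheses (r0' : forall i, 0 <= r' i) (s0' : forall j, 0 < s' j).
Hypotheses (T1 : T 1%:M = 1%:M) (TM : forall X Y, T (X *m Y) = T X *m T Y).
Hypothesis Tadj : forall X, T (adj X) = adj (T X).
Hypothesis Trho : forall X, rtr (spec E r *m T X) = rtr (spec E' r' *m X).
Hypothesis TK : forall X, rtr (spec G s *m T X) = rtr (spec G' s' *m X).

(** [Trho] and [TK] say that the primed operators are the images of the others under the dual of
    [T]. At each [t], [T] carries an optimal [Y] of the primed problem to a competitor of equal
    value in the other; [ln_sum_le] integrates this comparison. *)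
Lemma relative_entropy_monotone :
  rtr (spec E' r' *m spec E' (fun i => ln (r' i))) -
    rtr (spec E' r' *m spec G' (fun j => ln (s' j))) <=
  rtr (spec E r *m spec E (fun i => ln (r i))) -
    rtr (spec E r *m spec G (fun j => ln (s j))).
Proof.
rewrite !relative_entropy_spec //.
(* A signed weight on the disjoint union of the two sets of pairs turns the difference of the two
   relative entropies into a single sum. *)
pose c (k : (I * J) + (I' * J')) : R :=
  match k with inl ij => overlap E G ij | inr ij => - overlap E' G' ij end.
pose rr (k : (I * J) + (I' * J')) : R :=
  match k with inl ij => r ij.1 | inr ij => r' ij.1 end.
pose ss (k : (I * J) + (I' * J')) : R :=
  match k with inl ij => s ij.2 | inr ij => s' ij.2 end.
have rr0 k : 0 <= rr k by case: k => ij; [apply: r0 | apply: r0'].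
have ss0 k : 0 < ss k by case: k => ij; [apply: s0 | apply: s0'].
have crr : \sum_k c k * rr k = 0.
  rewrite big_sumType /=; under [X in _ + X]eq_bigr => ij _ do rewrite mulNr.
  rewrite sumrN -(rtr_specl E Gr) -(rtr_specl E' Gr').
  by rewrite -(mulmx1 (spec E r)) -T1 Trho mulmx1 subrr.
have dpos t : 0 < t -> 0 <= \sum_k c k * (rr k ^+ 2 / (t * rr k + ss k)).
  move=> t0; rewrite big_sumType /=.
  under [X in _ + X]eq_bigr => ij _ do rewrite mulNr.
  rewrite sumrN subr_ge0.
  have [Y <-] := qform_attained Er' Gr' r0' s0' t0.
  apply: le_trans (qform_le Er Gr r0 s0 t0 (T Y)).
  by rewrite /qform -Tadj -!TM !Trho TK.
have := ln_sum_le rr0 ss0 crr dpos; rewrite !big_sumType /=.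
under [X in _ + X <= _]eq_bigr => ij _ do rewrite mulNr.
under [X in _ <= _ + X]eq_bigr => ij _ do rewrite mulNr.
rewrite !sumrN.
lra.
Qed.

End Monotonicity.

(** The weights [w i j] are nonnegative, so the scalar inequality can be summed term by term. The
    isometry [V] compares operators on different spaces, and the trace of the second is taken only
    over the range of [V]. *)
Lemma klein n m (I J : finType) (E : I -> 'M[C]_m) (G : J -> 'M[C]_n)
    (r : I -> R) (s : J -> R) (V : 'M[C]_(n, m)) :
  resolution E -> resolution G -> (forall i, 0 <= r i) -> (forall j, 0 < s j) ->
  Defs.isometry V ->
  rtr (spec E r) - rtr (V *m adj V *m spec G s) <=
  rtr (spec E r *m spec E (fun i => ln (r i))) -
    rtr (V *m spec E r *m adj V *m spec G (fun j => ln (s j))).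
Proof.
move=> Er Gr r0 s0 VV.
pose w i j := rtr (V *m E i *m adj V *m G j).
have w0 i j : 0 <= w i j by rewrite /w rtrC; apply/(res_rtr_ge0 Er)/(res_psd Gr).
have wsum i : rtr (E i) = \sum_j w i j.
  by rewrite -(rtr_insert_right Gr) rtrC mulmxA VV mul1mx.
have main d e : rtr (V *m spec E d *m adj V *m spec G e) =
    \sum_i \sum_j w i j * (d i * e j).
  rewrite {1}/spec [V *m _]mulmx_sumr !mulmx_suml rtr_sum; apply: eq_bigr=> i _.
  rewrite /spec mulmx_sumr rtr_sum; apply: eq_bigr=> j _.
  by rewrite -!scalemxAr -!scalemxAl 2!rtrZ -/(w i j); ring.
have trE d : rtr (spec E d) = \sum_i \sum_j w i j * d i.
  rewrite /spec rtr_sum; apply: eq_bigr=> i _.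
  by rewrite rtrZ wsum mulrC mulr_suml.
have -> : spec E r *m spec E (fun i => ln (r i)) = spec E (fun i => r i * ln (r i)).
  rewrite {1}/spec mulmx_suml; apply: eq_bigr=> i _.
  by rewrite -scalemxAl res_spec // scalerA rmorphM.
have -> : V *m adj V *m spec G s = V *m spec E (fun=> 1) *m adj V *m spec G s.
  by rewrite (spec_cst Er) mulmx1.
rewrite !main !trE -!sumrB; apply: ler_sum=> i _; rewrite -!sumrB; apply: ler_sum=> j _.
rewrite -!mulrBr mul1r ler_wpM2l //.
(* At [r i = 0] the logarithmic terms vanish and only [- s j <= 0] remains. *)
have [->|ri] := eqVneq (r i) 0; first by rewrite mul0r sub0r oppr_le0 ltW.
by apply: ln_ge_1sub => //; rewrite lt_neqAle eq_sym ri r0.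
Qed.

End RelativeEntropy.

(** * Tensor products and partial traces *)

Section Tensor.
Variable R : realType.
Local Notation C := (R[i]).

Lemma big_mxtens (V : nmodType) m n (F : 'I_(m * n) -> V) :
  \sum_u F u = \sum_i \sum_j F (mxtens_index (i, j)).
Proof.
rewrite pair_big; apply: (reindex (fun p : 'I_m * 'I_n => mxtens_index (p.1, p.2))).
exists (@mxtens_unindex m n) => [[i j] _|u _]; first exact: mxtens_indexK.
by rewrite -surjective_pairing mxtens_unindexK.
Qed.

Lemma mxtens_index_eq m n (i k : 'I_m) (j l : 'I_n) :
  (mxtens_index (i, j) == mxtens_index (k, l)) = (i == k) && (j == l).
Proof. by rewrite (can_eq (@mxtens_indexK m n)) xpair_eqE. Qed.

Lemma tensmx_matrixP m n p q (A B : 'M[C]_(m * n, p * q)) :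
  (forall i j k l, A (mxtens_index (i, j)) (mxtens_index (k, l)) =
                   B (mxtens_index (i, j)) (mxtens_index (k, l))) -> A = B.
Proof.
by move=> AB; apply/matrixP=> u v; case: (mxtens_indexP u) => i j; case: (mxtens_indexP v).
Qed.

Lemma tensmx1 m n : tensmx (1%:M : 'M[C]_m) (1%:M : 'M[C]_n) = 1%:M.
Proof.
apply: tensmx_matrixP => i j k l.
by rewrite tensmxE !mxE mxtens_index_eq -natrM mulnb.
Qed.

Lemma tensmxDl m n p q (A B : 'M[C]_(m, n)) (D : 'M[C]_(p, q)) :
  tensmx (A + B) D = tensmx A D + tensmx B D.
Proof. by apply/matrixP=> u v; rewrite !mxE mulrDl. Qed.

Lemma tensmxDr m n p q (A B : 'M[C]_(m, n)) (D : 'M[C]_(p, q)) :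
  tensmx D (A + B) = tensmx D A + tensmx D B.
Proof. by apply/matrixP=> u v; rewrite !mxE mulrDr. Qed.

Lemma tensmxZl m n p q a (A : 'M[C]_(m, n)) (D : 'M[C]_(p, q)) :
  tensmx (a *: A) D = a *: tensmx A D.
Proof. by apply/matrixP=> u v; rewrite !mxE mulrA. Qed.

Lemma tensmxZr m n p q a (A : 'M[C]_(m, n)) (D : 'M[C]_(p, q)) :
  tensmx D (a *: A) = a *: tensmx D A.
Proof. by apply/matrixP=> u v; rewrite !mxE mulrCA. Qed.

Lemma tensmx_suml m n p q (I : finType) (F : I -> 'M[C]_(m, n)) (D : 'M[C]_(p, q)) :
  tensmx (\sum_i F i) D = \sum_i tensmx (F i) D.
Proof.
exact: (big_morph (fun X => tensmx X D) (fun A B => tensmxDl A B D) (tens0mx D)).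
Qed.

Lemma tensmx_sumr m n p q (I : finType) (F : I -> 'M[C]_(m, n)) (D : 'M[C]_(p, q)) :
  tensmx D (\sum_i F i) = \sum_i tensmx D (F i).
Proof.
exact: (big_morph (fun X => tensmx D X) (fun A B => tensmxDr A B D) (tensmx0 D)).
Qed.

Lemma tr_tensmx m n (A : 'M[C]_m) (B : 'M[C]_n) : \tr (tensmx A B) = \tr A * \tr B.
Proof.
rewrite /mxtrace big_mxtens mulr_suml; apply: eq_bigr=> i _.
by rewrite mulr_sumr; apply: eq_bigr=> j _; rewrite tensmxE.
Qed.

Lemma tr_mulmxE m n (A : 'M[C]_(m, n)) (B : 'M[C]_(n, m)) :
  \tr (A *m B) = \sum_i \sum_j A i j * B j i.
Proof. by apply: eq_bigr=> i _; rewrite mxE. Qed.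

(** The partial trace is dual to tensoring with the identity; its later properties are derived from
    this rather than from entries. *)
Lemma tr_ptrace_r m n (A : 'M[C]_(m * n)) (X : 'M[C]_m) :
  \tr (ptrace_r A *m X) = \tr (A *m tensmx X 1%:M).
Proof.
rewrite !tr_mulmxE big_mxtens; apply: eq_bigr=> i _.
transitivity (\sum_k \sum_j A (mxtens_index (i, j)) (mxtens_index (k, j)) * X k i).
  by apply: eq_bigr=> k _; rewrite mxE mulr_suml.
rewrite exchange_big /=; apply: eq_bigr=> j _.
rewrite big_mxtens; apply: eq_bigr=> k _; rewrite (bigD1 j) //= tensmxE mxE eqxx mulr1 big1 ?addr0 //.
by move=> j' j'j; rewrite tensmxE mxE (negPf j'j) mulr0 mulr0.
Qed.

Lemma tr_ptrace_l m n (A : 'M[C]_(m * n)) (X : 'M[C]_n) :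
  \tr (ptrace_l A *m X) = \tr (A *m tensmx 1%:M X).
Proof.
rewrite !tr_mulmxE big_mxtens [RHS]exchange_big /=; apply: eq_bigr=> j _.
transitivity (\sum_l \sum_i A (mxtens_index (i, j)) (mxtens_index (i, l)) * X l j).
  by apply: eq_bigr=> l _; rewrite mxE mulr_suml.
rewrite exchange_big /=; apply: eq_bigr=> i _.
rewrite big_mxtens (bigD1 i) //= [X in _ + X]big1 ?addr0.
  by apply: eq_bigr=> l _; rewrite tensmxE mxE eqxx mul1r.
move=> k ki; apply: big1 => l _.
by rewrite tensmxE mxE (negPf ki) mul0r mulr0.
Qed.

(** Nondegeneracy of the trace pairing, by testing on matrix units. *)
Lemma tr_mul_inj n (A B : 'M[C]_n) :
  (forall X, \tr (A *m X) = \tr (B *m X)) -> A = B.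
Proof.
move=> AB; apply/matrixP=> i j; have := AB (delta_mx j i).
have trd (D : 'M[C]_n) : \tr (D *m delta_mx j i) = D i j.
  rewrite tr_mulmxE (bigD1 i) //= (bigD1 j) //= !mxE !eqxx mulr1 big1 ?addr0.
    rewrite big1 ?addr0 // => k ki; apply: big1 => l _.
    by rewrite mxE [k == i](negPf ki) andbF mulr0.
  by move=> l lj; rewrite mxE (negPf lj) mulr0.
by rewrite !trd.
Qed.

(** On the dual side the isometry [W] acts on an identity factor and cancels against its adjoint. *)
Lemma ptrace_r_conj m n p q (V : 'M[C]_(p, m)) (W : 'M[C]_(q, n)) A :
  Defs.isometry W ->
  ptrace_r (tensmx V W *m A *m adj (tensmx V W)) = V *m ptrace_r A *m adj V.
Proof.
move=> WW; apply: tr_mul_inj => X.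
rewrite tr_ptrace_r -!mulmxA mxtrace_mulC [RHS]mxtrace_mulC -!mulmxA tr_ptrace_r.
by rewrite adj_tens !tensmx_mul mul1mx WW mulmxA.
Qed.

Lemma ptrace_l_conj m n p q (V : 'M[C]_(p, m)) (W : 'M[C]_(q, n)) A :
  Defs.isometry V ->
  ptrace_l (tensmx V W *m A *m adj (tensmx V W)) = W *m ptrace_l A *m adj W.
Proof.
move=> VV; apply: tr_mul_inj => X.
rewrite tr_ptrace_l -!mulmxA mxtrace_mulC [RHS]mxtrace_mulC -!mulmxA tr_ptrace_l.
by rewrite adj_tens !tensmx_mul mul1mx VV mulmxA.
Qed.

Lemma ptrace_r_psd m n (A : 'M[C]_(m * n)) : psdmx A -> psdmx (ptrace_r A).
Proof.
move=> Ap; apply: psdmxP => [|v].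
  apply/matrixP=> i j; rewrite adjE !mxE rmorph_sum; apply: eq_bigr=> k _.
  by rewrite -[in RHS](psdmx_adj Ap) adjE.
rewrite mxtrace_mulC mulmxA mxtrace_mulC tr_ptrace_r.
have := psdmx_conj_tr_ge0 (tensmx v (1%:M : 'M[C]_n)) Ap.
by rewrite mxtrace_mulC mulmxA adj_tens adj1 tensmx_mul mulmx1 mxtrace_mulC.
Qed.

Lemma ptrace_l_psd m n (A : 'M[C]_(m * n)) : psdmx A -> psdmx (ptrace_l A).
Proof.
move=> Ap; apply: psdmxP => [|v].
  apply/matrixP=> i j; rewrite adjE !mxE rmorph_sum; apply: eq_bigr=> k _.
  by rewrite -[in RHS](psdmx_adj Ap) adjE.
rewrite mxtrace_mulC mulmxA mxtrace_mulC tr_ptrace_l.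
have := psdmx_conj_tr_ge0 (tensmx (1%:M : 'M[C]_m) v) Ap.
by rewrite mxtrace_mulC mulmxA adj_tens adj1 tensmx_mul mulmx1 mxtrace_mulC.
Qed.

Lemma ptrace_lD m n (A B : 'M[C]_(m * n)) : ptrace_l (A + B) = ptrace_l A + ptrace_l B.
Proof.
by apply: tr_mul_inj => X; rewrite mulmxDl mxtraceD !tr_ptrace_l mulmxDl mxtraceD.
Qed.

Lemma ptrace_lZ m n a (A : 'M[C]_(m * n)) : ptrace_l (a *: A) = a *: ptrace_l A.
Proof.
by apply: tr_mul_inj => X; rewrite -scalemxAl mxtraceZ !tr_ptrace_l -scalemxAl mxtraceZ.
Qed.

Lemma ptrace_l1 m n : ptrace_l (1%:M : 'M[C]_(m * n)) = m%:R%:M.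
Proof.
apply: tr_mul_inj => X; rewrite tr_ptrace_l mul1mx tr_tensmx mxtrace1.
by rewrite mul_scalar_mx mxtraceZ.
Qed.

End Tensor.

(** * Zero-one matrices of index maps *)

Section Reindexing.
Variable R : realType.
Local Notation C := (R[i]).

(** Conjugation by this matrix reads entries through [f], so a reordering of tensor factors becomes
    a unitary conjugation. *)
Definition reindexmx m n (f : 'I_m -> 'I_n) : 'M[C]_(m, n) :=
  \matrix_(u, v) (f u == v)%:R.

Lemma reindexmx_mul m n p (f : 'I_m -> 'I_n) (A : 'M[C]_(n, p)) u v :
  (reindexmx f *m A) u v = A (f u) v.
Proof.
rewrite mxE (bigD1 (f u)) //= mxE eqxx mul1r big1 ?addr0 // => w wf.
by rewrite mxE eq_sym (negPf wf) mul0r.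
Qed.

Lemma mul_reindexmx_adj m n p (f : 'I_m -> 'I_n) (A : 'M[C]_(p, n)) u v :
  (A *m adj (reindexmx f)) u v = A u (f v).
Proof.
rewrite mxE (bigD1 (f v)) //= adjE mxE eqxx conjC1 mulr1 big1 ?addr0 // => w wf.
by rewrite adjE mxE eq_sym (negPf wf) conjC0 mulr0.
Qed.

Lemma reindexmx_conj m n (f : 'I_m -> 'I_n) (A : 'M[C]_n) u v :
  (reindexmx f *m A *m adj (reindexmx f)) u v = A (f u) (f v).
Proof. by rewrite mul_reindexmx_adj reindexmx_mul. Qed.

Lemma reindexmx_coisometry m n (f : 'I_m -> 'I_n) : injective f ->
  reindexmx f *m adj (reindexmx f) = 1%:M.
Proof.
move=> fI; apply/matrixP=> u v.
by rewrite mul_reindexmx_adj !mxE (inj_eq fI).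
Qed.

Lemma reindexmx_adj m n (f : 'I_m -> 'I_n) (g : 'I_n -> 'I_m) :
  cancel f g -> cancel g f -> adj (reindexmx f) = reindexmx g.
Proof.
move=> fg gf; apply/matrixP=> u v; rewrite adjE !mxE conjC_nat.
by rewrite -(can_eq gf) fg eq_sym.
Qed.

Lemma reindexmx_isometry m n (f : 'I_m -> 'I_n) (g : 'I_n -> 'I_m) :
  cancel f g -> cancel g f -> adj (reindexmx f) *m reindexmx f = 1%:M.
Proof.
move=> fg gf; have fE := reindexmx_adj fg gf.
by rewrite -[X in _ *m X]adjK fE reindexmx_coisometry //; apply: can_inj gf.
Qed.

End Reindexing.

(** * Reassociation of tensor factors, reduced states and local isometries *)

Section Reassociation.
Variable R : realType.
Local Notation C := (R[i]).

Definition assoc_idx a b c (u : 'I_(a * (b * c))) : 'I_(a * b * c) :=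
  let: (x, yz) := mxtens_unindex u in let: (y, z) := mxtens_unindex yz in
  mxtens_index (mxtens_index (x, y), z).

Definition unassoc_idx a b c (u : 'I_(a * b * c)) : 'I_(a * (b * c)) :=
  let: (xy, z) := mxtens_unindex u in let: (x, y) := mxtens_unindex xy in
  mxtens_index (x, mxtens_index (y, z)).

Lemma assoc_idxE a b c x y z :
  @assoc_idx a b c (mxtens_index (x, mxtens_index (y, z))) =
  mxtens_index (mxtens_index (x, y), z).
Proof. by rewrite /assoc_idx !mxtens_indexK. Qed.

Lemma unassoc_idxE a b c x y z :
  @unassoc_idx a b c (mxtens_index (mxtens_index (x, y), z)) =
  mxtens_index (x, mxtens_index (y, z)).
Proof. by rewrite /unassoc_idx !mxtens_indexK. Qed.

Lemma assoc_idxK a b c : cancel (@assoc_idx a b c) (@unassoc_idx a b c).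
Proof.
move=> u; case: (mxtens_indexP u) => x yz; case: (mxtens_indexP yz) => y z.
by rewrite assoc_idxE unassoc_idxE.
Qed.

Lemma unassoc_idxK a b c : cancel (@unassoc_idx a b c) (@assoc_idx a b c).
Proof.
move=> u; case: (mxtens_indexP u) => xy z; case: (mxtens_indexP xy) => x y.
by rewrite unassoc_idxE assoc_idxE.
Qed.

Definition assocmx a b c : 'M[C]_(a * (b * c), a * b * c) :=
  reindexmx R (@assoc_idx a b c).

Lemma assocmx_coisometry a b c : assocmx a b c *m adj (assocmx a b c) = 1%:M.
Proof. exact/reindexmx_coisometry/can_inj/assoc_idxK. Qed.

Lemma assocmx_isometry a b c : adj (assocmx a b c) *m assocmx a b c = 1%:M.
Proof. exact: (reindexmx_isometry R (@assoc_idxK a b c) (@unassoc_idxK a b c)). Qed.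

Lemma mxassocE a b c (M : 'M[C]_(a * b * c)) :
  mxassoc M = assocmx a b c *m M *m adj (assocmx a b c).
Proof.
apply/matrixP=> u v; rewrite reindexmx_conj.
case: (mxtens_indexP u) => x yz; case: (mxtens_indexP yz) => y z.
case: (mxtens_indexP v) => x' yz'; case: (mxtens_indexP yz') => y' z'.
by rewrite mxE !assoc_idxE !mxtens_indexK.
Qed.

Lemma mul_assocmx a b c p (A : 'M[C]_(p, a * (b * c))) u v :
  (A *m assocmx a b c) u v = A u (unassoc_idx v).
Proof.
rewrite -[assocmx a b c]adjK (reindexmx_adj R (@assoc_idxK a b c) (@unassoc_idxK a b c)).
by rewrite mul_reindexmx_adj.
Qed.

Lemma assocmx_tens a b c a' b' c'
    (A : 'M[C]_(a, a')) (B : 'M[C]_(b, b')) (D : 'M[C]_(c, c')) :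
  assocmx a b c *m tensmx (tensmx A B) D = tensmx A (tensmx B D) *m assocmx a' b' c'.
Proof.
apply/matrixP=> u v; rewrite reindexmx_mul mul_assocmx.
case: (mxtens_indexP u) => x yz; case: (mxtens_indexP yz) => y z.
case: (mxtens_indexP v) => xy' z'; case: (mxtens_indexP xy') => x' y'.
by rewrite assoc_idxE unassoc_idxE !tensmxE mulrA.
Qed.

(* [lift_BC Y] is [1 (x) Y] as an operator on [(A B) C]. *)
Definition lift_BC a b c (Y : 'M[C]_(b * c)) : 'M[C]_(a * b * c) :=
  adj (assocmx a b c) *m tensmx 1%:M Y *m assocmx a b c.

Lemma tr_red_BC a b c (rho : 'M[C]_(a * b * c)) Y :
  \tr (red_BC rho *m Y) = \tr (rho *m lift_BC a Y).
Proof. by rewrite /red_BC tr_ptrace_l mxassocE -!mulmxA mxtrace_mulC !mulmxA. Qed.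

Lemma tr_red_AB a b c (rho : 'M[C]_(a * b * c)) X :
  \tr (red_AB rho *m X) = \tr (rho *m tensmx X 1%:M).
Proof. exact: tr_ptrace_r. Qed.

Lemma lift_BC_tens a b c (X : 'M[C]_b) (Y : 'M[C]_c) :
  lift_BC a (tensmx X Y) = tensmx (tensmx 1%:M X) Y.
Proof.
by rewrite /lift_BC -mulmxA -assocmx_tens mulmxA assocmx_isometry mul1mx.
Qed.

(** [red_B] is defined through the BC marginal; by duality it is also the B marginal of AB, which is
    what monotonicity from AB to B needs. *)
Lemma tr_red_B a b c (rho : 'M[C]_(a * b * c)) X :
  \tr (red_B rho *m X) = \tr (red_AB rho *m tensmx 1%:M X).
Proof. by rewrite /red_B tr_ptrace_r tr_red_BC lift_BC_tens tr_red_AB. Qed.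

Lemma lift_BCE a b c (Y : 'M[C]_(b * c)) i j k i' j' k' :
  lift_BC a Y (mxtens_index (mxtens_index (i, j), k)) (mxtens_index (mxtens_index (i', j'), k')) =
  (i == i')%:R * Y (mxtens_index (j, k)) (mxtens_index (j', k')).
Proof.
rewrite /lift_BC mul_assocmx.
rewrite (reindexmx_adj R (@assoc_idxK a b c) (@unassoc_idxK a b c)) reindexmx_mul.
by rewrite !unassoc_idxE tensmxE mxE.
Qed.

Lemma red_AB_psd a b c (rho : 'M[C]_(a * b * c)) : psdmx rho -> psdmx (red_AB rho).
Proof. exact: ptrace_r_psd. Qed.

Lemma red_BC_psd a b c (rho : 'M[C]_(a * b * c)) : psdmx rho -> psdmx (red_BC rho).
Proof. by move=> rp; apply: ptrace_l_psd; rewrite mxassocE; apply: psdmx_conj. Qed.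

Lemma red_B_psd a b c (rho : 'M[C]_(a * b * c)) : psdmx rho -> psdmx (red_B rho).
Proof. by move=> rp; apply/ptrace_r_psd/red_BC_psd. Qed.

Section Embedding.
Variables (a b c a' b' c' : nat).
Variables (VA : 'M[C]_(a', a)) (VB : 'M[C]_(b', b)) (VC : 'M[C]_(c', c)).
Hypotheses (VAi : Defs.isometry VA) (VBi : Defs.isometry VB) (VCi : Defs.isometry VC).

Lemma tens_isometry m n p q (V : 'M[C]_(m, n)) (W : 'M[C]_(p, q)) :
  Defs.isometry V -> Defs.isometry W -> Defs.isometry (tensmx V W).
Proof. by move=> Vi Wi; rewrite /Defs.isometry adj_tens tensmx_mul Vi Wi tensmx1. Qed.

Variable rho : 'M[C]_(a * b * c).

Lemma red_AB_embed : red_AB (embed_state VA VB VC rho) =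
  tensmx VA VB *m red_AB rho *m adj (tensmx VA VB).
Proof. exact: ptrace_r_conj. Qed.

Lemma red_BC_embed : red_BC (embed_state VA VB VC rho) =
  tensmx VB VC *m red_BC rho *m adj (tensmx VB VC).
Proof.
rewrite /red_BC -(ptrace_l_conj (tensmx VB VC) _ VAi).
congr ptrace_l; rewrite !mxassocE /embed_state !mulmxA assocmx_tens.
by rewrite -!mulmxA -!adjM assocmx_tens !mulmxA.
Qed.

Lemma red_B_embed : red_B (embed_state VA VB VC rho) = VB *m red_B rho *m adj VB.
Proof. by rewrite /red_B red_BC_embed ptrace_r_conj. Qed.

Lemma embed_state_psd : psdmx rho -> psdmx (embed_state VA VB VC rho).
Proof. exact: psdmx_conj. Qed.

Lemma embed_isometry : Defs.isometry (tensmx (tensmx VA VB) VC).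
Proof. by do 2?[apply: tens_isometry]. Qed.

Lemma embed_state_tr : \tr (embed_state VA VB VC rho) = \tr rho.
Proof. by rewrite /embed_state mxtrace_mulC mulmxA embed_isometry mul1mx. Qed.

End Embedding.

(** [V] intertwines [A] with its conjugate, hence also their logarithms, and the conjugate gives no
    weight to the complement of the range. *)
Lemma vN_entropy_conj m n (A : 'M[C]_n) (V : 'M[C]_(m, n)) :
  psdmx A -> Defs.isometry V -> vN_entropy (V *m A *m adj V) = vN_entropy A.
Proof.
move=> Ap Vi; have Bp := psdmx_conj V Ap.
have [E [d [Er AE AL _]]] := spectral_resolution (psdmx_adj Ap).
have [G [e [Gr BE BL _]]] := spectral_resolution (psdmx_adj Bp).
have inter : spec G e *m V = V *m spec E d.
  by rewrite -BE -AE -mulmxA Vi mulmx1.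
rewrite /vN_entropy; congr (- complex.Re _).
rewrite BL AL -!mulmxA mxtrace_mulC -!mulmxA.
by rewrite (spec_intertwine (@ln R) Gr Er inter) (mulmxA (adj V)) Vi mul1mx.
Qed.

Lemma cond_mutual_info_embed a b c a' b' c' (VA : 'M[C]_(a', a)) (VB : 'M[C]_(b', b))
    (VC : 'M[C]_(c', c)) (rho : 'M[C]_(a * b * c)) :
  Defs.isometry VA -> Defs.isometry VB -> Defs.isometry VC -> psdmx rho ->
  cond_mutual_info (embed_state VA VB VC rho) = cond_mutual_info rho.
Proof.
move=> VAi VBi VCi rp; rewrite /cond_mutual_info red_AB_embed // red_BC_embed //.
rewrite red_B_embed // !vN_entropy_conj //;
  by [apply: tens_isometry | apply: embed_isometry | apply: red_AB_psd
     | apply: red_BC_psd | apply: red_B_psd].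
Qed.

End Reassociation.

(** * Unital star-homomorphisms and lifts of operators to larger tensor products *)

Section StarHom.
Variable R : realType.
Local Notation C := (R[i]).

(** Such maps send resolutions to resolutions and so commute with the functional calculus. *)
Definition star_hom m n (phi : 'M[C]_m -> 'M[C]_n) : Prop :=
  [/\ phi 1%:M = 1%:M, forall X Y, phi (X *m Y) = phi X *m phi Y,
      forall X, phi (adj X) = adj (phi X), forall X Y, phi (X + Y) = phi X + phi Y &
      forall a X, phi (a *: X) = a *: phi X].

Lemma star_hom_comp m n p (phi : 'M[C]_n -> 'M[C]_p) (psi : 'M[C]_m -> 'M[C]_n) :
  star_hom phi -> star_hom psi -> star_hom (phi \o psi).
Proof.
move=> [f1 fM fA fD fZ] [g1 gM gA gD gZ]; split=> /= [|X Y|X|X Y|a X].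
- by rewrite g1 f1.
- by rewrite gM fM.
- by rewrite gA fA.
- by rewrite gD fD.
- by rewrite gZ fZ.
Qed.

Lemma star_hom_sum m n (phi : 'M[C]_m -> 'M[C]_n) (I : finType) (F : I -> 'M[C]_m) :
  star_hom phi -> phi (\sum_i F i) = \sum_i phi (F i).
Proof.
move=> [_ _ _ fD fZ]; apply: (big_morph phi fD).
by have := fZ 0 0; rewrite !scale0r.
Qed.

Lemma star_hom_res m n (phi : 'M[C]_m -> 'M[C]_n) (I : finType) (E : I -> 'M[C]_m) :
  star_hom phi -> resolution E -> resolution (fun i => phi (E i)).
Proof.
move=> fh Er; have [f1 fM fA fD fZ] := fh; split=> [i|i j|].
- by rewrite -fA (res_adj Er).
- rewrite -fM (resM Er); case: eqP => // _.
  by have := fZ 0 0; rewrite !scale0r.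
- by rewrite -star_hom_sum // (res_sum Er).
Qed.

Lemma star_hom_spec m n (phi : 'M[C]_m -> 'M[C]_n) (I : finType) (E : I -> 'M[C]_m) d :
  star_hom phi -> phi (spec E d) = spec (fun i => phi (E i)) d.
Proof.
move=> fh; rewrite star_hom_sum //; apply: eq_bigr=> i _.
by case: fh => _ _ _ _ fZ; rewrite fZ.
Qed.

Lemma star_hom_tensl m n : star_hom (fun X : 'M[C]_m => tensmx X (1%:M : 'M[C]_n)).
Proof.
split=> [|X Y|X|X Y|a X]; first exact: tensmx1.
- by rewrite tensmx_mul mulmx1.
- by rewrite adj_tens adj1.
- exact: tensmxDl.
- exact: tensmxZl.
Qed.

Lemma star_hom_tensr m n : star_hom (fun X : 'M[C]_n => tensmx (1%:M : 'M[C]_m) X).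
Proof.
split=> [|X Y|X|X Y|a X]; first exact: tensmx1.
- by rewrite tensmx_mul mulmx1.
- by rewrite adj_tens adj1.
- exact: tensmxDr.
- exact: tensmxZr.
Qed.

Lemma star_hom_conj m n (U : 'M[C]_(m, n)) : U *m adj U = 1%:M -> adj U *m U = 1%:M ->
  star_hom (fun X => U *m X *m adj U).
Proof.
move=> UU UU'; split=> [|X Y|X|X Y|a X]; first by rewrite mulmx1.
- by rewrite !mulmxA -(mulmxA _ (adj U) U) UU' mulmx1.
- by rewrite !adjM adjK mulmxA.
- by rewrite mulmxDr mulmxDl.
- by rewrite -scalemxAr -scalemxAl.
Qed.

Lemma star_hom_lift_BC a b c : star_hom (@lift_BC R a b c).
Proof.
have := star_hom_comp (star_hom_conj (U := adj (assocmx R a b c)) _ _) (star_hom_tensr a (b * c)).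
rewrite adjK; apply; [exact: assocmx_isometry | exact: assocmx_coisometry].
Qed.

(* [lift_AL X] is [X (x) 1] as an operator on [A (L N)]. *)
Definition lift_AL a l n (X : 'M[C]_(a * l)) : 'M[C]_(a * (l * n)) :=
  mxassoc (tensmx X (1%:M : 'M[C]_n)).

Lemma star_hom_lift_AL a l n : star_hom (@lift_AL a l n).
Proof.
have h := star_hom_comp (star_hom_conj (assocmx_coisometry R a l n) (assocmx_isometry R a l n))
  (star_hom_tensl (a * l) n).
have E X : lift_AL n X = assocmx R a l n *m tensmx X 1%:M *m adj (assocmx R a l n).
  by rewrite /lift_AL mxassocE.
by case: h => h1 h2 h3 h4 h5; split=> *; rewrite !E //; [apply: h2 | apply: h3 | apply: h4 | apply: h5].
Qed.

Lemma lift_ALE a l n (X : 'M[C]_(a * l)) i j k i' j' k' :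
  lift_AL n X (mxtens_index (i, mxtens_index (j, k))) (mxtens_index (i', mxtens_index (j', k'))) =
  X (mxtens_index (i, j)) (mxtens_index (i', j')) * (k == k')%:R.
Proof. by rewrite mxE !mxtens_indexK tensmxE mxE. Qed.

Lemma ptrace_l_lift_AL a l n (X : 'M[C]_(a * l)) :
  ptrace_l (lift_AL n X) = tensmx (ptrace_l X) 1%:M.
Proof.
apply: tensmx_matrixP => j k j' k'; rewrite tensmxE !mxE mulr_suml.
by apply: eq_bigr=> i _; rewrite lift_ALE.
Qed.

(* [blockmx] is the reordering of [A (L N) C] as [(A L) (N C)]. *)
Definition block_idx a l n c (u : 'I_(a * (l * n) * c)) : 'I_((a * l) * (n * c)) :=
  let: (xy, z) := mxtens_unindex u in let: (x, y) := mxtens_unindex xy in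
  let: (i, k) := mxtens_unindex y in
  mxtens_index (mxtens_index (x, i), mxtens_index (k, z)).

Definition unblock_idx a l n c (u : 'I_((a * l) * (n * c))) : 'I_(a * (l * n) * c) :=
  let: (xi, kz) := mxtens_unindex u in let: (x, i) := mxtens_unindex xi in
  let: (k, z) := mxtens_unindex kz in
  mxtens_index (mxtens_index (x, mxtens_index (i, k)), z).

Lemma block_idxE a l n c x i k z :
  @block_idx a l n c (mxtens_index (mxtens_index (x, mxtens_index (i, k)), z)) =
  mxtens_index (mxtens_index (x, i), mxtens_index (k, z)).
Proof. by rewrite /block_idx !mxtens_indexK. Qed.

Lemma unblock_idxE a l n c x i k z :
  @unblock_idx a l n c (mxtens_index (mxtens_index (x, i), mxtens_index (k, z))) =
  mxtens_index (mxtens_index (x, mxtens_index (i, k)), z).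
Proof. by rewrite /unblock_idx !mxtens_indexK. Qed.

Lemma block_idxK a l n c : cancel (@block_idx a l n c) (@unblock_idx a l n c).
Proof.
move=> u; case: (mxtens_indexP u) => xy z; case: (mxtens_indexP xy) => x y.
by case: (mxtens_indexP y) => i k; rewrite block_idxE unblock_idxE.
Qed.

Lemma unblock_idxK a l n c : cancel (@unblock_idx a l n c) (@block_idx a l n c).
Proof.
move=> u; case: (mxtens_indexP u) => xi kz; case: (mxtens_indexP xi) => x i.
by case: (mxtens_indexP kz) => k z; rewrite unblock_idxE block_idxE.
Qed.

Definition blockmx a l n c : 'M[C]_(a * (l * n) * c, (a * l) * (n * c)) :=
  reindexmx R (@block_idx a l n c).

Lemma blockmx_coisometry a l n c : blockmx a l n c *m adj (blockmx a l n c) = 1%:M.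
Proof. exact/reindexmx_coisometry/can_inj/block_idxK. Qed.

Lemma blockmx_isometry a l n c : adj (blockmx a l n c) *m blockmx a l n c = 1%:M.
Proof. exact: (reindexmx_isometry R (@block_idxK a l n c) (@unblock_idxK a l n c)). Qed.

Lemma blockmx_tensl a l n c (X : 'M[C]_(a * l)) :
  blockmx a l n c *m tensmx X 1%:M *m adj (blockmx a l n c) = tensmx (lift_AL n X) 1%:M.
Proof.
apply: tensmx_matrixP => xy z xy' z'; case: (mxtens_indexP xy) => x y.
case: (mxtens_indexP xy') => x' y'; case: (mxtens_indexP y) => i k.
case: (mxtens_indexP y') => i' k'.
rewrite reindexmx_conj !block_idxE !tensmxE lift_ALE -tensmx1 tensmxE !mxE.
by rewrite mulrA.
Qed.

Lemma blockmx_tensr a l n c (Y : 'M[C]_(n * c)) :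
  blockmx a l n c *m tensmx 1%:M Y *m adj (blockmx a l n c) = lift_BC a (lift_BC l Y).
Proof.
apply: tensmx_matrixP => xy z xy' z'; case: (mxtens_indexP xy) => x y.
case: (mxtens_indexP xy') => x' y'; case: (mxtens_indexP y) => i k.
case: (mxtens_indexP y') => i' k'.
rewrite reindexmx_conj !block_idxE !lift_BCE -tensmx1 !tensmxE !mxE.
by rewrite mulrA.
Qed.

(** The lifts act on the complementary factors A L and N C. Together with [lift_BC_AL] this shows
    that they commute. *)
Lemma lift_AL_BC a l n c (X : 'M[C]_(a * l)) (Y : 'M[C]_(n * c)) :
  tensmx (lift_AL n X) 1%:M *m lift_BC a (lift_BC l Y) =
  blockmx a l n c *m tensmx X Y *m adj (blockmx a l n c).
Proof.
rewrite -blockmx_tensl -blockmx_tensr !mulmxA.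
rewrite -(mulmxA _ (adj (blockmx a l n c)) (blockmx a l n c)) blockmx_isometry mulmx1.
by rewrite -(mulmxA _ (tensmx X _)) tensmx_mul mulmx1 mul1mx.
Qed.

Lemma lift_BC_AL a l n c (X : 'M[C]_(a * l)) (Y : 'M[C]_(n * c)) :
  lift_BC a (lift_BC l Y) *m tensmx (lift_AL n X) 1%:M =
  blockmx a l n c *m tensmx X Y *m adj (blockmx a l n c).
Proof.
rewrite -blockmx_tensl -blockmx_tensr !mulmxA.
rewrite -(mulmxA _ (adj (blockmx a l n c)) (blockmx a l n c)) blockmx_isometry mulmx1.
by rewrite -(mulmxA _ (tensmx _ Y)) tensmx_mul mulmx1 mul1mx.
Qed.

Lemma tensl_lift_BC_comm l n c (X : 'M[C]_l) (Y : 'M[C]_(n * c)) :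
  tensmx (tensmx X 1%:M) 1%:M *m lift_BC l Y =
  lift_BC l Y *m tensmx (tensmx X 1%:M) 1%:M.
Proof.
rewrite /lift_BC !mulmxA -[RHS]mulmxA assocmx_tens tensmx1.
rewrite -!mulmxA mulmxA -[tensmx (tensmx X _) _]adjK -adjM !adj_tens !adj1.
rewrite assocmx_tens adjM !adj_tens adjK !adj1 tensmx1 -!mulmxA.
by congr (_ *m _); rewrite !mulmxA; congr (_ *m _); rewrite !tensmx_mul !mul1mx !mulmx1.
Qed.

End StarHom.

(** * Logarithms of intertwined operators *)

Section Logs.
Variable R : realType.
Local Notation C := (R[i]).

(* An operator [X] intertwined with [mu] by an isometry [V] agrees with [mu] on
   the range of [V]; the kernel condition gives the null space of [X] no weight,
   so enlarging the eigenvalues of [X] can only increase the logarithm. *)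
Lemma log_intertwine_le n m (I : finType) (rho mu : 'M[C]_n) (V : 'M[C]_(m, n))
    (N : I -> 'M[C]_m) (d d' : I -> R) :
  psdmx rho -> adj mu = mu -> (kermx mu <= kermx rho)%MS -> Defs.isometry V ->
  resolution N -> spec N d *m V = V *m mu ->
  (forall i, 0 <= d i <= d' i) ->
  rtr (rho *m mxlog mu) <= rtr (V *m rho *m adj V *m spec N (fun i => ln (d' i))).
Proof.
move=> rp muh ker Vi Nr inter dd.
have [M [e [Mr muE muL _]]] := spectral_resolution muh.
have inter' : spec N d *m V = V *m spec M e by rewrite inter muE.
have lnV := spec_intertwine (@ln R) Nr Mr inter'.
have -> : rtr (rho *m mxlog mu) = rtr (V *m rho *m adj V *m spec N (fun i => ln (d i))).
  by rewrite muL [RHS]rtrC !mulmxA lnV [RHS]rtrC !mulmxA Vi mul1mx rtrC.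
rewrite rtrC [X in _ <= X]rtrC !rtr_spec; apply: ler_sum=> i _.
have /andP[d0 dd'] := dd i.
have w0 : 0 <= rtr (N i *m (V *m rho *m adj V)).
  have := psdmx_conj_rtr_ge0 (N i *m V) rp.
  by rewrite adjM (res_adj Nr) [X in X -> _]/= !mulmxA [rtr (_ *m N i)]rtrC !mulmxA (resK Nr).
(* The value [ln 0 = 0] may exceed [ln (d' i)], so these terms must vanish: the rows of [N i *m V]
   lie in the kernel of [mu], hence in that of [rho]. *)
have [di0|di] := eqVneq (d i) 0.
  have NV : N i *m V *m mu = 0.
    by rewrite -mulmxA -inter mulmxA (res_spec Nr) di0 scale0r mul0mx.
  have : (N i *m V <= kermx rho)%MS by apply: submx_trans ker; apply/sub_kermxP.
  by move/sub_kermxP => NVr; rewrite !mulmxA NVr mul0mx rtr0 !mulr0.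
have dpos : 0 < d i by rewrite lt_neqAle eq_sym di d0.
by rewrite ler_wpM2r // ler_ln // posrE ?(lt_le_trans dpos dd').
Qed.

End Logs.

(** * The inequality on a product of four systems *)

Section Core.
Variable R : realType.
Local Notation C := (R[i]).

Lemma rtr_red_AB a b c (rho : 'M[C]_(a * b * c)) X :
  rtr (rho *m tensmx X 1%:M) = rtr (red_AB rho *m X).
Proof. by rewrite /rtr tr_red_AB. Qed.

Lemma rtr_red_BC a b c (rho : 'M[C]_(a * b * c)) Y :
  rtr (rho *m lift_BC a Y) = rtr (red_BC rho *m Y).
Proof. by rewrite /rtr tr_red_BC. Qed.

Lemma vN_entropy_spec n (I : finType) (A : 'M[C]_n) (E : I -> 'M[C]_n) d :
  A = spec E d -> mxlog A = spec E (fun i => ln (d i)) ->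
  vN_entropy A = - rtr (spec E d *m spec E (fun i => ln (d i))).
Proof. by move=> AE AL; rewrite /vN_entropy AL {1}AE. Qed.

Lemma isometry1 n : Defs.isometry (1%:M : 'M[C]_n).
Proof. by rewrite /Defs.isometry adj1 mulmx1. Qed.

(** [S] and [T] are arbitrary positive operators on A L and N C, given with spectral data; the
    Markov structure enters only later. *)
Variables (x y z l n : nat) (rho0 : 'M[C]_(x * y * z)) (V0 : 'M[C]_(l * n, y)).
Variables (I J K : finType) (S : 'M[C]_(x * l)) (T : 'M[C]_(n * z)).
Variables (G : I -> 'M[C]_(x * l)) (H : J -> 'M[C]_(n * z)) (g : K -> 'M[C]_l).
Variables (s : I -> R) (t : J -> R) (e : K -> R) (eps : R).
Hypotheses (rho0p : psdmx rho0) (tr_rho0 : \tr rho0 = 1) (V0i : Defs.isometry V0).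
Hypotheses (Gr : resolution G) (Hr : resolution H) (gr : resolution g).
Hypotheses (SE : S = spec G s) (TE : T = spec H t) (sE : ptrace_l S = spec g e).
Hypotheses (s0 : forall i, 0 <= s i) (t0 : forall j, 0 <= t j) (e0 : forall k, 0 <= e k).
Hypothesis eps0 : 0 < eps.

Let rho := embed_state (1%:M : 'M[C]_x) V0 (1%:M : 'M[C]_z) rho0.
Let lnS := spec G (fun i => ln (s i + eps)).
Let lnT := spec H (fun j => ln (t j + eps)).
(** The shift carries the factor [x%:R] because tracing A out of [S + eps] adds [eps] once for each
    dimension of A. *)
Let lns := spec g (fun k => ln (e k + x%:R * eps)).
Let rho_p : psdmx rho := embed_state_psd _ _ _ rho0p.

(** A matrix of trace one cannot have dimension zero. *)
Lemma dim_gt0 : 0 < x%:R * eps.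
Proof.
rewrite mulr_gt0 // ltr0n lt0n; apply/eqP => x0.
move: rho0 tr_rho0; rewrite x0 => r.
by rewrite /mxtrace big_ord0 => /eqP; rewrite eq_sym oner_eq0.
Qed.

Let se_gt0 i : 0 < s i + eps. Proof. by rewrite ltr_wpDl. Qed.
Let te_gt0 i : 0 < t i + eps. Proof. by rewrite ltr_wpDl. Qed.
Let ee_gt0 k : 0 < e k + x%:R * eps. Proof. by rewrite ltr_wpDl // dim_gt0. Qed.

Let sp_shift m (A : finType) (E : A -> 'M[C]_m) d (r : R) : resolution E ->
  spec E (fun i => d i + r) = spec E d + r%:C%C%:M.
Proof. by move=> Er; rewrite specD (spec_cst Er). Qed.

(** Monotonicity from AB to B, with the shifted [S] and its partial trace, each tensored with the
    identity of N, as second arguments. Entropies are stated for [rho0] since the embedding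
    preserves them. *)
Lemma core_AB :
  - vN_entropy (red_B rho0) - rtr (red_B rho *m tensmx lns 1%:M) <=
  - vN_entropy (red_AB rho0) - rtr (red_AB rho *m lift_AL n lnS).
Proof.
have ABp := red_AB_psd rho_p; have Bp := red_B_psd rho_p.
have [E [r [Er rE rL /(_ ABp) r0]]] := spectral_resolution (psdmx_adj ABp).
have [E' [r' [Er' rE' rL' /(_ Bp) r0']]] := spectral_resolution (psdmx_adj Bp).
have -> : vN_entropy (red_AB rho0) = vN_entropy (red_AB rho).
  rewrite red_AB_embed ?vN_entropy_conj //; first exact: red_AB_psd.
    by apply: tens_isometry => //; apply: isometry1.
  exact: isometry1.
have -> : vN_entropy (red_B rho0) = vN_entropy (red_B rho).
  rewrite red_B_embed ?vN_entropy_conj //; try exact: isometry1.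
  exact: red_B_psd.
rewrite (vN_entropy_spec rE rL) (vN_entropy_spec rE' rL') !opprK rE rE'.
rewrite /lnS /lns (star_hom_spec _ _ (star_hom_lift_AL R x l n)).
rewrite (star_hom_spec _ _ (star_hom_tensl R l n)).
apply: (@relative_entropy_monotone R (x * (l * n)) (l * n) _ _ _ _ E _ r _ E' _ r' _
  (fun X => tensmx 1%:M X)) => //.
- exact: star_hom_res (star_hom_lift_AL R x l n) Gr.
- exact: star_hom_res (star_hom_tensl R l n) gr.
- exact: tensmx1.
- by move=> X Y; rewrite tensmx_mul mulmx1.
- by move=> X; rewrite adj_tens adj1.
- by move=> X; rewrite -rE -rE' /rtr tr_red_B.
(* The duality for the second arguments: tracing A out of the lift of [S + eps] gives the shifted
   [ptrace_l S] tensored with the identity. *)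
move=> X; rewrite -(star_hom_spec _ _ (star_hom_lift_AL R x l n)).
rewrite -(star_hom_spec _ _ (star_hom_tensl R l n)).
rewrite /rtr -tr_ptrace_l ptrace_l_lift_AL (sp_shift s eps Gr) (sp_shift e (x%:R * eps) gr) -SE -sE ptrace_lD.
have <- : eps%:C%C * x%:R = (x%:R * eps)%:C%C by rewrite mulrC rmorphM rmorph_nat.
by rewrite -[(eps%:C%C)%:M]scalemx1 ptrace_lZ ptrace_l1 scale_scalar_mx.
Qed.

(** Klein's inequality for the BC marginal against the commuting product of the shifted [ptrace_l S]
    and [T]; the logarithm of this product splits into two terms. *)
Lemma core_BC :
  1 - rtr (tensmx (V0 *m adj V0) 1%:M *m
      (tensmx (tensmx (ptrace_l S + (x%:R * eps)%:C%C%:M) 1%:M) 1%:M *m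
       lift_BC l (T + eps%:C%C%:M))) <=
  - vN_entropy (red_BC rho0) - rtr (red_B rho *m tensmx lns 1%:M) -
    rtr (red_BC rho *m lift_BC l lnT).
Proof.
have BCp := red_BC_psd rho0p.
have [E [r [Er rE rL /(_ BCp) r0]]] := spectral_resolution (psdmx_adj BCp).
have h1 := star_hom_comp (star_hom_tensl R (l * n) z) (star_hom_tensl R l n).
have h2 := star_hom_lift_BC R l n z.
have r1 := star_hom_res h1 gr; have r2 := star_hom_res h2 Hr.
have comm i j := tensl_lift_BC_comm (g i) (H j).
pose N ij := tensmx (tensmx (g ij.1) (1%:M : 'M[C]_n)) (1%:M : 'M[C]_z) *m lift_BC l (H ij.2).
have Nr : resolution N by exact: (commuting_resolution r1 r2 comm).
have Vi : Defs.isometry (tensmx V0 (1%:M : 'M[C]_z)).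
  by apply: tens_isometry => //; apply: isometry1.
have lnE : spec N (fun ij => ln ((e ij.1 + x%:R * eps) * (t ij.2 + eps))) =
    tensmx (tensmx lns 1%:M) 1%:M + lift_BC l lnT.
  rewrite (star_hom_spec _ _ h2 : lift_BC l lnT = _).
  rewrite (star_hom_spec _ _ h1 : tensmx (tensmx lns 1%:M) 1%:M = _).
  rewrite -(spec_commutingD _ _ r1 r2); apply: eq_spec => ij.
  by rewrite lnM ?posrE.
have KE : spec N (fun ij => (e ij.1 + x%:R * eps) * (t ij.2 + eps)) =
    tensmx (tensmx (ptrace_l S + (x%:R * eps)%:C%C%:M) 1%:M) 1%:M *m lift_BC l (T + eps%:C%C%:M).
  rewrite sE TE -!sp_shift // (star_hom_spec _ _ h2 : lift_BC l (spec H _) = _).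
  rewrite (star_hom_spec _ _ h1 : tensmx (tensmx (spec g _) 1%:M) 1%:M = _).
  by rewrite -spec_commutingM.
have pos ij : 0 < (e ij.1 + x%:R * eps) * (t ij.2 + eps) by rewrite mulr_gt0.
have := klein Er Nr r0 pos Vi.
have VV : tensmx V0 1%:M *m adj (tensmx V0 1%:M) = tensmx (V0 *m adj V0) (1%:M : 'M[C]_z).
  by rewrite adj_tens adj1 tensmx_mul mulmx1.
have hv : rtr (spec E r *m spec E (fun i => ln (r i))) = - vN_entropy (red_BC rho0).
  by rewrite (vN_entropy_spec rE rL) opprK.
rewrite KE lnE VV hv -rE.
have -> : rtr (red_BC rho0) = 1.
  have -> : red_BC rho0 = red_BC rho0 *m 1%:M by rewrite mulmx1.
  by rewrite -rtr_red_BC /lift_BC tensmx1 mulmx1 assocmx_isometry mulmx1 /rtr tr_rho0.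
rewrite -(red_BC_embed V0 1%:M (isometry1 x)) -/rho.
rewrite mulmxDr rtrD opprD addrA.
have -> : rtr (red_BC rho *m tensmx (tensmx lns 1%:M) 1%:M) =
   rtr (red_B rho *m tensmx lns 1%:M) by rewrite /rtr -tr_ptrace_r.
by [].
Qed.

(** Adding the two preceding bounds cancels the terms in [lns]. *)
Lemma core_inequality : cond_mutual_info rho0 <= - vN_entropy rho0 -
  rtr (rho *m (tensmx (lift_AL n lnS) 1%:M + lift_BC x (lift_BC l lnT))) - 1 +
  rtr (tensmx (V0 *m adj V0) 1%:M *m
      (tensmx (tensmx (ptrace_l S + (x%:R * eps)%:C%C%:M) 1%:M) 1%:M *m
       lift_BC l (T + eps%:C%C%:M))).
Proof.
have := core_AB; have := core_BC.
rewrite mulmxDr rtrD (rtr_red_AB rho) (rtr_red_BC rho) /cond_mutual_info.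
by move: (rtr _) (rtr _) (rtr _) (rtr _) => a b c d; lra.
Qed.

End Core.

(** * Markov states *)

Section Markov.
Variable R : realType.
Local Notation C := (R[i]).

(** The coordinates of the direct sum are the dependent pairs of a block and an index in it; [u j]
    is the inclusion of block [j]. *)
Lemma direct_sum_isometries (m : nat) (l : 'I_m -> nat) :
  exists (L : nat) (u : forall j, 'M[C]_(L, l j)),
    (forall j, Defs.isometry (u j)) /\ (forall j k, j != k -> adj (u j) *m u k = 0).
Proof.
pose idx j (i : 'I_(l j)) := enum_rank (Tagged (fun j => 'I_(l j)) i).
exists _, (fun j => adj (reindexmx R (idx j))); split=> [j|j k jk]; last first.
  apply/matrixP=> i i'; rewrite adjK mul_reindexmx_adj !mxE (can_eq enum_rankK).
  case: eqP => // /(congr1 (@tag _ _)) /= jk'.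
  by rewrite jk' eqxx in jk.
rewrite /Defs.isometry adjK; apply: reindexmx_coisometry => i i' /(can_inj enum_rankK).
by move/eqP; rewrite -tag_eqE /tag_eq eqxx /= tagged_asE => /eqP.
Qed.

Lemma mul_blockmx a l n c p (A : 'M[C]_(p, a * (l * n) * c)) u v :
  (A *m blockmx R a l n c) u v = A u (unblock_idx v).
Proof.
rewrite -[blockmx R a l n c]adjK (reindexmx_adj R (@block_idxK a l n c) (@unblock_idxK a l n c)).
by rewrite mul_reindexmx_adj.
Qed.

Lemma block_embE x y z l n (W : 'M[C]_(y, l * n)) :
  block_emb W = tensmx (tensmx (1%:M : 'M_x) W) (1%:M : 'M_z) *m blockmx R x l n z.
Proof.
apply/matrixP=> u v; rewrite mul_blockmx mxE.
case: (mxtens_indexP u) => xy k; case: (mxtens_indexP xy) => i j.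
case: (mxtens_indexP v) => xi nz; case: (mxtens_indexP xi) => i' j'.
case: (mxtens_indexP nz) => m' k'.
rewrite unblock_idxE !mxtens_indexK !tensmxE !mxE -mulnb natrM.
by rewrite mulrAC.
Qed.

Lemma blockmx_tens x z l n l' n' (u : 'M[C]_(l', l)) (v : 'M[C]_(n', n)) :
  tensmx (tensmx (1%:M : 'M_x) (tensmx u v)) (1%:M : 'M_z) *m blockmx R x l n z =
  blockmx R x l' n' z *m tensmx (tensmx 1%:M u) (tensmx v 1%:M).
Proof.
apply/matrixP=> a b; rewrite mul_blockmx reindexmx_mul.
case: (mxtens_indexP a) => xy k; case: (mxtens_indexP xy) => i y.
case: (mxtens_indexP y) => j m.
case: (mxtens_indexP b) => xi nz; case: (mxtens_indexP xi) => i' j'.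
case: (mxtens_indexP nz) => m' k'.
by rewrite unblock_idxE block_idxE !tensmxE !mulrA.
Qed.

(** After reassociation the operator is a tensor product of [X] with an operator on N C. *)
Lemma tr_tens_lift_BC l n c (X : 'M[C]_l) (Y : 'M[C]_n) (T : 'M[C]_(n * c)) :
  \tr (tensmx (tensmx X Y) 1%:M *m lift_BC l T) = \tr X * \tr (tensmx Y 1%:M *m T).
Proof.
rewrite /lift_BC !mulmxA mxtrace_mulC !mulmxA assocmx_tens.
rewrite -(mulmxA _ (assocmx _ _ _ _)) assocmx_coisometry mulmx1.
by rewrite tensmx_mul mulmx1 tr_tensmx.
Qed.

Lemma rtr_mul_shift k (Q A B : 'M[C]_k) (f1 f2 : R) :
  rtr (Q *m ((A + f1%:C%C *: 1%:M) *m (B + f2%:C%C *: 1%:M))) =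
  rtr (Q *m (A *m B)) + f2 * rtr (Q *m A) + f1 * rtr (Q *m B) + f1 * f2 * rtr Q.
Proof.
have shift (P : 'M[C]_k) : rtr (P *m (B + f2%:C%C *: 1%:M)) = rtr (P *m B) + f2 * rtr P.
  by rewrite mulmxDr -scalemxAr mulmx1 rtrD rtrZ.
rewrite mulmxA [LHS]shift mulmxDr -scalemxAr mulmx1 [rtr (_ + _)]rtrD rtrZ.
rewrite mulmxDl -scalemxAl rtrD rtrZ mulmxA.
by move: (rtr _) (rtr _) (rtr _) (rtr _) => g1 g2 g3 g4; ring.
Qed.

Lemma le_of_small_perturbation (a b c1 c2 : R) :
  (forall eps, 0 < eps -> a <= b + eps * c1 + eps ^+ 2 * c2) -> a <= b.
Proof.
move=> h; apply/ler_addgt0Pr => e e0.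
(* The summand [e] makes [m] positive and [e / m] at most 1, so its square is no larger than itself
   and both error terms together stay below [e]. *)
pose m := `|c1| + `|c2| + e.
have m0 : 0 < m by rewrite ltr_wpDl // addr_ge0.
have em : e <= m by rewrite lerDr addr_ge0.
have eps0 : 0 < e / m by rewrite divr_gt0.
have eps1 : e / m <= 1 by rewrite ler_pdivrMr // mul1r.
apply: le_trans (h _ eps0) _; rewrite -addrA lerD2l.
have h1 : e / m * c1 <= e / m * `|c1| by rewrite ler_wpM2l ?ler_norm // ltW.
have h2 : (e / m) ^+ 2 * c2 <= e / m * `|c2|.
  apply: (@le_trans _ _ ((e / m) ^+ 2 * `|c2|)).
    by rewrite ler_wpM2l ?ler_norm // sqr_ge0.
  by rewrite ler_wpM2r // expr2 ler_piMl // ltW.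
apply: le_trans (lerD h1 h2) _; rewrite -mulrDr mulrAC ler_pdivrMr //.
by rewrite ler_wpM2l ?(ltW e0) // lerDl ltW.
Qed.

(** The finite case, where the right-hand side is the relative entropy. [log_intertwine_le] bounds
    the term in [mxlog mu] by the shifted logarithms of [S] and [T], and [core_inequality] applies
    up to an error polynomial in [eps]. *)
Lemma markov_relative_entropy x y z (rho mu : 'M[C]_(x * y * z)) :
  is_state rho -> markov_state mu -> (kermx mu <= kermx rho)%MS ->
  cond_mutual_info rho <= - vN_entropy rho - rtr (rho *m mxlog mu).
Proof.
have combine (f f1 f2 f3 f4 : R) : f1 <= f2 ->
    - f - f2 - 1 + (1 + f3 + f4) <= - f - f1 + f3 + f4 by lra.
move=> [rp tr1] [m [l [n [W [p [sigma [tau [[Wi Wo] Wsum [p0 p1] st muE]]]]]]]] ker.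
have [L [u [ui uo]]] := direct_sum_isometries l.
have [N [v [vi vo]]] := direct_sum_isometries n.
(* [V0] sends block [j] of B to the tensor product of its two factors inside L and N. *)
pose V0 : 'M[C]_(L * N, y) := \sum_j tensmx (u j) (v j) *m adj (W j).
have V0W k : V0 *m W k = tensmx (u k) (v k).
  rewrite mulmx_suml (bigD1 k) //= big1 ?addr0 => [|j jk].
    by rewrite -mulmxA Wi mulmx1.
  by rewrite -mulmxA Wo // mulmx0.
have V0V0 : V0 *m adj V0 = \sum_j tensmx (u j *m adj (u j)) (v j *m adj (v j)).
  rewrite {1}/V0 mulmx_suml; apply: eq_bigr=> j _.
  by rewrite -mulmxA -adjM V0W adj_tens tensmx_mul.
have V0i : Defs.isometry V0.
  rewrite /Defs.isometry -[RHS]Wsum {2}/V0 mulmx_sumr; apply: eq_bigr=> k _.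
  rewrite mulmxA; congr (_ *m _).
  rewrite adj_sum mulmx_suml (bigD1 k) //= big1 ?addr0 => [|j jk].
    by rewrite adjM adjK adj_tens -mulmxA tensmx_mul ui vi tensmx1 mulmx1.
  by rewrite adjM adjK adj_tens -mulmxA tensmx_mul uo // tens0mx mulmx0.
pose U j : 'M[C]_(x * L, x * l j) := tensmx 1%:M (u j).
pose V j : 'M[C]_(N * z, n j * z) := tensmx (v j) 1%:M.
have Ui j : adj (U j) *m U j = 1%:M by rewrite adj_tens adj1 tensmx_mul mulmx1 ui tensmx1.
have Uo j k : j != k -> adj (U j) *m U k = 0.
  by move=> jk; rewrite adj_tens adj1 tensmx_mul uo // tensmx0.
have Vi j : adj (V j) *m V j = 1%:M by rewrite adj_tens adj1 tensmx_mul mulmx1 vi tensmx1.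
have Vo j k : j != k -> adj (V j) *m V k = 0.
  by move=> jk; rewrite adj_tens adj1 tensmx_mul vo // tens0mx.
(* The probabilities are all placed in [S]. The mixed blocks of [S] and [T], with distinct indices,
   lie outside the range of [V0]. *)
pose S := \sum_j (p j)%:C%C *: (U j *m sigma j *m adj (U j)).
pose T := \sum_j V j *m tau j *m adj (V j).
have SU k : S *m U k = (p k)%:C%C *: (U k *m sigma k).
  rewrite mulmx_suml (bigD1 k) //= big1 ?addr0 => [|j jk].
    by rewrite -scalemxAl -mulmxA Ui mulmx1.
  by rewrite -scalemxAl -mulmxA Uo // mulmx0 scaler0.
have TV k : T *m V k = V k *m tau k.
  rewrite mulmx_suml (bigD1 k) //= big1 ?addr0 => [|j jk].
    by rewrite -mulmxA Vi mulmx1.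
  by rewrite -mulmxA Vo // mulmx0.
have Sp : psdmx S.
  by apply: psdmx_sum => j _; apply/psdmxZ/psdmx_conj/(st j).1.1.
have Tp : psdmx T by apply: psdmx_sum => j _; apply/psdmx_conj/(st j).2.1.
pose VV := tensmx (tensmx (1%:M : 'M[C]_x) V0) (1%:M : 'M[C]_z).
have VVi : Defs.isometry VV by apply: embed_isometry => //; apply: isometry1.
pose Pi := blockmx R x L N z.
have VVE k : VV *m block_emb (W k) = Pi *m tensmx (U k) (V k).
  by rewrite block_embE mulmxA !tensmx_mul !mulmx1 V0W blockmx_tens.
have Esum : \sum_j block_emb (W j) *m adj (block_emb (W j)) = 1%:M :> 'M[C]_(x * y * z).
  rewrite -tensmx1 -tensmx1 -Wsum tensmx_sumr tensmx_suml; apply: eq_bigr=> j _.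
  rewrite block_embE adjM mulmxA -(mulmxA _ (blockmx _ _ _ _ _)) blockmx_coisometry mulmx1.
  by rewrite !adj_tens !adj1 !tensmx_mul !mulmx1.
(* The identity is checked on each block, where both sides act as [p j] times [sigma j] tensor
   [tau j]. *)
have inter : Pi *m tensmx S T *m adj Pi *m VV = VV *m mu.
  rewrite -[LHS]mulmx1 -Esum mulmx_sumr muE mulmx_sumr; apply: eq_bigr=> j _.
  rewrite mulmxA -(mulmxA _ VV) VVE mulmxA -(mulmxA _ (adj Pi)) blockmx_isometry mulmx1.
  rewrite -(mulmxA Pi) tensmx_mul SU TV tensmxZl -tensmx_mul -!scalemxAr -!scalemxAl.
  congr (_ *: _).
  have E := mulmxA VV (block_emb (W j)) (tensmx (sigma j) (tau j)).
  rewrite VVE in E.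
  by rewrite (mulmxA VV) E (mulmxA Pi).
have muh : adj mu = mu.
  rewrite muE adj_sum; apply: eq_bigr=> j _.
  have [/psdmx_adj sh _] := (st j).1; have [/psdmx_adj th _] := (st j).2.
  by rewrite adjZ !adjM adjK adj_tens sh th mulmxA.
have [G [s [Gr SE _ /(_ Sp) s0]]] := spectral_resolution (psdmx_adj Sp).
have [H [t [Hr TE _ /(_ Tp) t0]]] := spectral_resolution (psdmx_adj Tp).
have sp := ptrace_l_psd Sp.
have [g [e [gr sE _ /(_ sp) e0]]] := spectral_resolution (psdmx_adj sp).
have hA := star_hom_comp (star_hom_tensl R (x * (L * N)) z) (star_hom_lift_AL R x L N).
have hB := star_hom_comp (star_hom_lift_BC R x (L * N) z) (star_hom_lift_BC R L N z).
have rA := star_hom_res hA Gr; have rB := star_hom_res hB Hr.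
pose M ij := tensmx (lift_AL N (G ij.1)) (1%:M : 'M[C]_z) *m lift_BC x (lift_BC L (H ij.2)).
have Mr : resolution M.
  by apply: (commuting_resolution rA rB) => i j /=; rewrite lift_AL_BC lift_BC_AL.
have XE : spec M (fun ij => s ij.1 * t ij.2) = Pi *m tensmx S T *m adj Pi.
  rewrite -lift_AL_BC SE TE.
  rewrite (star_hom_spec _ _ hA : tensmx (lift_AL N (spec G s)) 1%:M = _).
  by rewrite (star_hom_spec _ _ hB : lift_BC x (lift_BC L (spec H t)) = _) -spec_commutingM.
pose QQ := tensmx (V0 *m adj V0) (1%:M : 'M[C]_z).
pose AA := tensmx (tensmx (ptrace_l S) (1%:M : 'M[C]_N)) (1%:M : 'M[C]_z).
pose BB := lift_BC L T.
(* On the image of B only matching blocks survive, and block [j] contributes [p j]. *)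
have trQAB : rtr (QQ *m (AA *m BB)) = 1.
  rewrite /QQ V0V0 tensmx_suml mulmx_suml rtr_sum.
  have trj j : rtr (tensmx (tensmx (u j *m adj (u j)) (v j *m adj (v j))) 1%:M *m (AA *m BB)) = p j.
    rewrite mulmxA !tensmx_mul !mulmx1 /rtr tr_tens_lift_BC.
    have -> : \tr (u j *m adj (u j) *m ptrace_l S) = (p j)%:C%C.
      rewrite mxtrace_mulC tr_ptrace_l.
      have -> : tensmx 1%:M (u j *m adj (u j)) = U j *m adj (U j).
        by rewrite adj_tens adj1 tensmx_mul mulmx1.
      rewrite mulmxA SU -scalemxAl mxtraceZ mxtrace_mulC mulmxA Ui mul1mx.
      by rewrite (st j).1.2 mulr1.
    have -> : tensmx (v j *m adj (v j)) 1%:M = V j *m adj (V j).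
      by rewrite adj_tens adj1 tensmx_mul mulmx1.
    rewrite [X in _ * X]mxtrace_mulC mulmxA TV [X in _ * X]mxtrace_mulC mulmxA Vi mul1mx.
    by rewrite (st j).2.2 mulr1.
  by under eq_bigr => j _ do rewrite trj.
(* The coefficients are those of [eps] and its square in [expand] below. *)
apply: (@le_of_small_perturbation _ _ (rtr (QQ *m AA) + x%:R * rtr (QQ *m BB)) (x%:R * rtr QQ)).
move=> eps eps0.
have core := core_inequality rp tr1 V0i Gr Hr gr SE TE sE s0 t0 e0 eps0.
have dd ij : 0 <= s ij.1 * t ij.2 <= (s ij.1 + eps) * (t ij.2 + eps).
  by rewrite mulr_ge0 //= ler_pM // lerDl ltW.
have lnle := log_intertwine_le rp muh ker VVi Mr (etrans (congr1 (mulmx^~ VV) XE) inter) dd.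
have lnE : spec M (fun ij => ln ((s ij.1 + eps) * (t ij.2 + eps))) =
    tensmx (lift_AL N (spec G (fun i => ln (s i + eps)))) 1%:M +
    lift_BC x (lift_BC L (spec H (fun j => ln (t j + eps)))).
  rewrite (star_hom_spec _ _ hA : tensmx (lift_AL N (spec G _)) 1%:M = _).
  rewrite (star_hom_spec _ _ hB : lift_BC x (lift_BC L (spec H _)) = _).
  rewrite -(spec_commutingD _ _ rA rB); apply: eq_spec => ij.
  by rewrite lnM // posrE ltr_wpDl.
have expand : rtr (QQ *m (tensmx (tensmx (ptrace_l S + (x%:R * eps)%:C%C%:M) 1%:M) 1%:M *m
      lift_BC L (T + eps%:C%C%:M))) =
    1 + eps * (rtr (QQ *m AA) + x%:R * rtr (QQ *m BB)) + eps ^+ 2 * (x%:R * rtr QQ).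
  have -> : tensmx (tensmx (ptrace_l S + (x%:R * eps)%:C%C%:M) (1%:M : 'M[C]_N)) (1%:M : 'M[C]_z) =
      AA + (x%:R * eps)%:C%C *: 1%:M.
    by rewrite -[(_%:C%C)%:M]scalemx1 !tensmxDl !tensmxZl !tensmx1.
  have -> : lift_BC L (T + eps%:C%C%:M) = BB + eps%:C%C *: 1%:M.
    have [h1 _ _ hD hZ] := star_hom_lift_BC R L N z.
    by rewrite -[(_%:C%C)%:M]scalemx1 hD hZ h1.
  by rewrite rtr_mul_shift trQAB; move: (rtr _) (rtr _) (rtr _) => f1 f2 f3; ring.
rewrite lnE in lnle; rewrite expand in core.
exact: le_trans core (combine _ _ _ _ _ lnle).
Qed.

Lemma cond_mutual_info_le_rel_entropy x y z (rho mu : 'M[C]_(x * y * z)) :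
  is_state rho -> markov_state mu ->
  ((cond_mutual_info rho)%:E <= rel_entropy rho mu)%E.
Proof.
move=> rs mum; rewrite /rel_entropy; case: ifP => [ker|_]; last exact: leey.
rewrite lee_fin; apply: le_trans (markov_relative_entropy rs mum ker) _.
by rewrite mulmxBr -/(rtr _) rtrB /vN_entropy -/(rtr _) opprK.
Qed.

End Markov.

Theorem theorem4 (R : realType) (a b c : nat) (rho : 'M[R[i]]_(a * b * c)) :
  is_state rho -> ((cond_mutual_info rho)%:E <= Delta rho)%E.
Proof.
move=> [rp tr1]; apply/ereal_infP => _ [a' [b' [c' [VA [VB [VC [mu [VAi VBi VCi mum ->]]]]]]]].
(* Local isometries preserve the conditional mutual information, so the bound may be proved on the
   enlarged systems. *)
rewrite -(cond_mutual_info_embed VAi VBi VCi rp).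
apply: cond_mutual_info_le_rel_entropy => //; split; first exact: embed_state_psd.
by rewrite embed_state_tr.
Qed.
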